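(* Let $k\ge 2$ be an integer, and let $\gamma\in(0,1]$, $\varepsilon>0$ and $\alpha,\delta\in(0,1)$. For a parameter $\lambda>0$, consider the following private-coin shuffle protocol $\mathcal{P}_{\mathsf{UT}}=(\mathcal{R}_{\mathsf{UT}},\mathcal{A}_{\mathsf{UT}})$ for $N\sim\mathbf{Poi}(n)$ users (the value of $N$ is known to the users and to the analyser), each holding one sample $x\in[k]$. Randomiser $\mathcal{R}_{\mathsf{UT}}(x)$: for each $j\in[k]$, output the message $(j,\mathbf{1}\{x=j\})$; then draw $s_j\sim\mathbf{Poi}(\lambda/N)$ and output $s_j$ further messages $(j,b_{j,1}),\dots,(j,b_{j,s_j})$, with $b_{j,t}\sim\mathrm{Bernoulli}(1/2)$ independent. All randomness is independent across users and coordinates. Analyser $\mathcal{A}_{\mathsf{UT}}$: given the shuffled multiset of all messages, set $\mu=\frac{n}{k}+\frac{\lambda}{2}$, let $N_j$ be the number of messages equal to $(j,1)$, compute $Z=\frac{k}{n}\sum_{j=1}^k\big((N_j-\mu)^2-N_j\big)$, and output ``not uniform'' if $Z>2n\alpha^2$ and ``uniform'' otherwise. Then there exists $\lambda=\lambda(\varepsilon,\delta)\in\mathbb{R}$ such that $\mathcal{P}_{\mathsf{UT}}$ is $(2\varepsilon,4\delta^\gamma,\gamma)$-robustly shuffle private. Moreover, for $\varepsilon=O(1)$ and $\delta=o(1)$, $\mathcal{P}_{\mathsf{UT}}$ solves $\alpha$-uniformity testing with sample complexity \[ n=O\Big(\frac{k^{3/4}}{\alpha\varepsilon}\log^{1/2}\frac1\delta+\frac{k^{1/2}}{\alpha^2}\Big).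 \]
   Context: Two datasets in $\mathcal{X}^m$ are adjacent if they differ in at most one entry. A randomised algorithm $\mathcal{M}:\mathcal{X}^m\to\mathcal{Z}$ is $(\varepsilon,\delta)$-differentially private (DP) if $\Pr[\mathcal{M}(\vec x)\in S]\le e^\varepsilon\Pr[\mathcal{M}(\vec x')\in S]+\delta$ for all measurable $S$ and all adjacent $\vec x,\vec x'$. In a (non-interactive) shuffle protocol, each user applies a randomiser $\mathcal{R}$ to its data point producing a tuple of messages, a shuffler $\mathcal{S}$ concatenates all users' tuples and outputs a uniformly random permutation of them, and an analyser computes the output from the shuffled messages. The protocol is $(\varepsilon',\delta',\gamma)$-robustly shuffle private if, for every fixed public randomness, the shuffler's output on the messages of any $\gamma$-fraction of the users (i.e. $\mathcal{S}\circ\mathcal{R}^{\gamma m}$, viewed as a function of those users' data) is $(\varepsilon',\delta')$-DP. $\mathbf{U}=\mathbf{U}_k$ denotes the uniform distribution on $[k]=\{1,\dots,k\}$ and $d_{TV}(\mathbf{p},\mathbf{q})=\frac12\|\mathbf{p}-\mathbf{q}\|_1$. A protocol solves $\alpha$-uniformity testing with sample complexity $n$ if, when the users' samples are i.i.d. from an unknown distribution $\mathbf{p}$ on $[k]$ (here with a Poissonised number $N\sim\mathbf{Poi}(n)$ of users), it outputs ``uniform'' with probability at least $2/3$ when $\mathbf{p}=\mathbf{U}$, and ``not uniform'' with probability at least $2/3$ when $d_{TV}(\mathbf{p},\mathbf{U})>\alpha$. *)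

(* Defs.v *)
From HB Require Import structures.
From mathcomp Require Import all_boot all_order all_algebra all_fingroup.
From mathcomp Require Import all_classical all_reals all_analysis.
Set Implicit Arguments. Unset Strict Implicit. Unset Printing Implicit Defensive.
Import Order.TTheory GRing.Theory Num.Theory.
Local Open Scope ring_scope.
Local Open Scope classical_set_scope.

Section UT.
Variable R : realType.

Definition poi (r : R) (s : nat) : R := expR (- r) * r ^+ s / (s`!)%:R.

Definition msg (k : nat) := ('I_k * bool)%type.

(* Private coins of one user: for each coordinate j, the list l j of the extra
   Bernoulli(1/2) bits b_{j,1..s_j}; its length is s_j ~ Poi(lam/N).
   Mass of a coin outcome: prod_j Poi(lam/N)(s_j) * 2^{-s_j}. *)
Definition coin_mass (k N : nat) (lam : R) (l : {ffun 'I_k -> seq bool}) : R :=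
  \prod_(j < k) (poi (lam / N%:R) (size (l j)) * (2^-1) ^+ size (l j)).

Definition rand_msgs (k : nat) (x : 'I_k) (l : {ffun 'I_k -> seq bool}) : seq (msg k) :=
  flatten [seq (j, x == j) :: [seq (j, b) | b <- l j] | j <- enum 'I_k].

Definition all_msgs (k m : nat) (xs : {ffun 'I_m -> 'I_k})
    (w : {ffun 'I_m -> {ffun 'I_k -> seq bool}}) : seq (msg k) :=
  flatten [seq rand_msgs (xs i) (w i) | i <- enum 'I_m].

Definition permute (T : Type) (s : seq T) (sigma : 'S_(size s)) : seq T :=
  [seq tnth (in_tuple s) (sigma i) | i <- enum 'I_(size s)].

Definition shuffle_prob (T : Type) (s : seq T) (S : set (seq T)) : R :=
  (\sum_(sigma : 'S_(size s)) (`[< S (permute sigma) >] : bool)%:R) / (size s)`!%:R.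

(* Pr[ S o R_UT^m (xs) \in S ], for m users with data xs, where the randomiser
   uses the parameter lam / N (N = total number of users, public). *)
Definition shuffler_prob (k m N : nat) (lam : R) (xs : {ffun 'I_m -> 'I_k})
    (S : set (seq (msg k))) : \bar R :=
  \esum_(w in [set: {ffun 'I_m -> {ffun 'I_k -> seq bool}}])
    ((\prod_(i < m) coin_mass N lam (w i)) * shuffle_prob (all_msgs xs w) S)%:E.

Definition adjacent (k m : nat) (xs xs' : {ffun 'I_m -> 'I_k}) : bool :=
  (#|[pred i | xs i != xs' i]| <= 1)%N.

(* (eps, del)-differential privacy of a randomised algorithm on ('I_k)^m with
   discrete (countable) output type Z; all subsets of Z are measurable. *)
Definition is_DP (k m : nat) (Z : Type) (M : {ffun 'I_m -> 'I_k} -> set Z -> \bar R)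
    (eps del : R) : Prop :=
  forall xs xs', adjacent xs xs' ->
    forall S : set Z, (M xs S <= (expR eps)%:E * M xs' S + del%:E)%E.

(* (eps', del', gam)-robust shuffle privacy of P_UT with parameter lam:
   for every total number N of users and every number m of honest users
   forming at least a gam-fraction, S o R^m is (eps', del')-DP. *)
Definition robustly_shuffle_private (k : nat) (lam eps' del' gam : R) : Prop :=
  forall N m : nat, gam * N%:R <= m%:R -> (m <= N)%N ->
    is_DP (fun (xs : {ffun 'I_m -> 'I_k}) S => shuffler_prob N lam xs S) eps' del'.

Definition count_ones (k : nat) (out : seq (msg k)) (j : 'I_k) : nat :=
  count (pred1 (j, true)) out.

Definition UT_stat (k : nat) (n lam : R) (out : seq (msg k)) : R :=
  let mu := n / k%:R + lam / 2 in
  k%:R / n * \sum_(j < k) (((count_ones out j)%:R - mu) ^+ 2 - (count_ones out j)%:R).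

(* true = "not uniform", false = "uniform" *)
Definition UT_output (k : nat) (n lam alpha : R) (out : seq (msg k)) : bool :=
  2 * n * alpha ^+ 2 < UT_stat n lam out.

Definition UT_prob (k : nat) (n lam alpha : R) (p : 'I_k -> R) (b : bool) : \bar R :=
  \esum_(N in [set: nat]) ((poi n N)%:E *
    \sum_(xs : {ffun 'I_N -> 'I_k})
      ((\prod_(i < N) p (xs i))%:E *
       shuffler_prob N lam xs [set out | UT_output n lam alpha out = b]))%E.

Definition prob_dist (k : nat) (p : 'I_k -> R) : Prop :=
  (forall j, 0 <= p j) /\ \sum_(j < k) p j = 1.

Definition unif (k : nat) : 'I_k -> R := fun _ => k%:R^-1.

Definition dTV (k : nat) (p q : 'I_k -> R) : R := 2^-1 * \sum_(j < k) `|p j - q j|.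

Definition solves_UT (k : nat) (n lam alpha : R) : Prop :=
  ((2 / 3)%:E <= UT_prob n lam alpha (@unif k) false)%E /\
  forall p : 'I_k -> R, prob_dist p -> alpha < dTV p (@unif k) ->
    ((2 / 3)%:E <= UT_prob n lam alpha p true)%E.

End UT.

(* Main.v *)
Require Import Defs.
From HB Require Import structures.
From mathcomp Require Import all_boot all_order all_algebra all_fingroup.
From mathcomp Require Import all_classical all_reals all_analysis.
From mathcomp Require Import ring lra.
Import Order.TTheory GRing.Theory Num.Theory.
Local Open Scope ring_scope.
Local Open Scope classical_set_scope.
Set Implicit Arguments. Unset Strict Implicit. Unset Printing Implicit Defensive.

(** Splitting a Poisson number of uniform bits by value gives independent Poisson counts, so the
   shuffled output is a random permutation of a multiset whose multiplicities are independent
   Poisson variables, shifted by the honest messages (j, 1{x = j}).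

   Privacy.  Changing one datum from x to y replaces the shift e_(x,1) + e_(y,0) by
   e_(y,1) + e_(x,0).  The Mecke identity E[v_a v_b G(v)] = rho^2 E[G(v + e_a + e_b)] turns this
   comparison into the pointwise inequality v_a v_b <= exp(2 eps) v_c v_d, which fails only if one
   of four Poisson counts deviates from its mean rho by a factor exp(eps / 2); Chernoff bounds each
   of these four events by del^gam.  Working with min(eps, 1) covers large eps.

   Utility.  With N ~ Poi(n) users the counts N_j are independent Poi(nu_j), and
   (N_j - mu)^2 - N_j has mean (nu_j - mu)^2 and variance 2 nu_j^2 + 4 nu_j (nu_j - mu)^2, so
   Chebyshev's inequality separates the two cases. *)

(** * Sums over countable types *)

Section Esum.
Variable R : realType.
Local Open Scope ereal_scope.

Lemma esum_finType (T : finType) (f : T -> \bar R) :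
  (forall x, 0 <= f x) -> \esum_(x in [set: T]) f x = \sum_x f x.
Proof.
move=> f0; rewrite esum_fset//; last exact: finite_finset.
rewrite [RHS](fsbig_seq _ _ (index_enum_uniq T)); apply: eq_fsbigl.
by apply/seteqP; split => // x _ /=; rewrite mem_index_enum.
Qed.

Lemma esum_pair (T U : choiceType) (f : T -> U -> \bar R) :
  (forall t u, 0 <= f t u) ->
  \esum_(t in [set: T]) \esum_(u in [set: U]) f t u =
  \esum_(z in [set: T * U]) f z.1 z.2.
Proof.
move=> f0; rewrite esum_esum//; congr esum.
by apply/seteqP; split => -[].
Qed.

Lemma esum_bij (T U : choiceType) (e : T -> U) (f : U -> \bar R) :
  bijective e -> \esum_(u in [set: U]) f u = \esum_(t in [set: T]) f (e t).
Proof. by rewrite -setTT_bijective; exact: reindex_esum. Qed.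

Lemma exchange_esum (T U : choiceType) (f : T -> U -> \bar R) :
  (forall t u, 0 <= f t u) ->
  \esum_(t in [set: T]) \esum_(u in [set: U]) f t u =
  \esum_(u in [set: U]) \esum_(t in [set: T]) f t u.
Proof.
move=> f0; rewrite !esum_pair//.
rewrite (esum_bij (e := fun z : U * T => (z.2, z.1)))//.
by exists (fun z => (z.2, z.1)) => -[].
Qed.

Lemma esumZ (T : choiceType) (c : R) (f : T -> \bar R) (D : set T) :
  (0 <= c)%R -> (forall t, 0 <= f t) ->
  \esum_(t in D) (c%:E * f t) = c%:E * \esum_(t in D) f t.
Proof.
(* A positive factor passes through the supremum that defines [\esum]; the factor 0 is treated
   apart. *)
rewrite le_eqVlt => /orP[/eqP <- _|c0 f0].
  by rewrite mul0e esum1// => t _; rewrite mul0e.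
rewrite /esum -ereal_sup_pZl//; congr ereal_sup.
have sumZ (X : set T) : \sum_(x \in X) (c%:E * f x) = c%:E * \sum_(x \in X) f x.
  by rewrite -ge0_mule_fsumr.
apply/seteqP; split => [_ [X XD <-]|_ [_ [X XD <-] <-]] /=.
  by exists (\sum_(x \in X) f x); [exists X|rewrite sumZ].
by exists X => //; rewrite sumZ.
Qed.

Lemma esum_seq (J : finType) (f : seq J -> \bar R) :
  (forall l, 0 <= f l) ->
  \esum_(l in [set: seq J]) f l =
  \esum_(N in [set: nat]) \sum_(t : N.-tuple J) f t.
Proof.
move=> f0; rewrite (_ : setT = \bigcup_(N in setT) [set l : seq J | size l = N]); last first.
  by apply/seteqP; split => // l _; exists (size l).
rewrite esum_bigcupT//; last by move=> i j _ _ [l [/= <- <-]].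
apply: eq_esum => N _; rewrite -esum_finType//.
apply: (@reindex_esum _ _ _ _ _ (@tval N J) f); split => //=.
- by move=> t _; exact: size_tuple.
- by move=> t u _ _; exact: val_inj.
- by move=> l /= /eqP lN; exists (Tuple lN).
Qed.

(** Splitting off coordinate 0 in this way allows induction on the number of independent factors. *)
Definition fcons (T : Type) n (t : T) (w : {ffun 'I_n -> T}) : {ffun 'I_n.+1 -> T} :=
  [ffun i => oapp w t (unlift ord0 i)].

Lemma fcons0 (T : Type) n (t : T) (w : {ffun 'I_n -> T}) : fcons t w ord0 = t.
Proof. by rewrite ffunE unlift_none. Qed.

Lemma fconsS (T : Type) n (t : T) (w : {ffun 'I_n -> T}) i :
  fcons t w (lift ord0 i) = w i.
Proof. by rewrite ffunE liftK. Qed.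

Lemma esum_ffun0 (T : choiceType) (f : {ffun 'I_0 -> T} -> \bar R)
    (w : {ffun 'I_0 -> T}) : (forall w, 0 <= f w) ->
  \esum_(w in [set: {ffun 'I_0 -> T}]) f w = f w.
Proof.
move=> f0; rewrite (_ : setT = [set w]) ?esum_set1//.
by apply/seteqP; split => // u _; apply/ffunP => -[].
Qed.

Lemma esum_ffunS (T : choiceType) n (f : {ffun 'I_n.+1 -> T} -> \bar R) :
  (forall w, 0 <= f w) ->
  \esum_(w in [set: {ffun 'I_n.+1 -> T}]) f w =
  \esum_(t in [set: T]) \esum_(w in [set: {ffun 'I_n -> T}]) f (fcons t w).
Proof.
move=> f0; rewrite esum_pair//.
apply: (esum_bij (e := fun z : T * {ffun 'I_n -> T} => fcons z.1 z.2)).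
exists (fun w : {ffun 'I_n.+1 -> T} => (w ord0, [ffun i => w (lift ord0 i)])) => [[t w]|w] /=.
  by congr pair; rewrite ?fcons0//; apply/ffunP => i; rewrite ffunE fconsS.
apply/ffunP => i; case: (unliftP ord0 i) => [j ->|->]; rewrite ?fconsS ?fcons0//.
by rewrite ffunE.
Qed.

(** Induction on [n]: the hypothesis pushes coordinate 0 forward, the induction hypothesis the
    others. Phrasing the pushforward by integrals of nonnegative functions lets the lemma be applied
    to its own conclusion, over the coordinates and then over the users. *)
Lemma esum_prod_push (T U : choiceType) (p : T -> R) (q : U -> R) (h : T -> U) n
    (G : {ffun 'I_n -> U} -> \bar R) :
  (forall t, 0 <= p t)%R -> (forall u, 0 <= q u)%R ->
  (forall g : U -> \bar R, (forall u, 0 <= g u) ->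
    \esum_(t in [set: T]) ((p t)%:E * g (h t)) =
    \esum_(u in [set: U]) ((q u)%:E * g u)) ->
  (forall u, 0 <= G u) ->
  \esum_(w in [set: {ffun 'I_n -> T}]) ((\prod_i p (w i))%:E * G [ffun i => h (w i)]) =
  \esum_(u in [set: {ffun 'I_n -> U}]) ((\prod_i q (u i))%:E * G u).
Proof.
move=> p0 q0 pq; elim: n G => [|n IH] G G0.
  have G0' (r : R) (x : \bar R) : (0 <= r)%R -> 0 <= x -> 0 <= r%:E * x.
    by move=> ? ?; rewrite mule_ge0.
  case: (pselect (inhabited {ffun 'I_0 -> T})) => [[w]|nw]; last first.
    by exfalso; apply: nw; split; apply: finfun; case.
  rewrite (esum_ffun0 w) ?(esum_ffun0 [ffun i => h (w i)]) ?big_ord0//.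
  - by move=> u; rewrite G0' ?prodr_ge0.
  - by move=> u; rewrite G0' ?prodr_ge0.
have P0 (V : Type) (r : V -> R) (r0 : forall v, (0 <= r v)%R) m (v : {ffun 'I_m -> V}) :
    (0 <= \prod_i r (v i))%R by apply: prodr_ge0.
rewrite !esum_ffunS; [|by move=> *; rewrite mule_ge0 ?lee_fin ?P0..].
transitivity (\esum_(t in [set: T]) ((p t)%:E *
   \esum_(u in [set: {ffun 'I_n -> U}]) ((\prod_i q (u i))%:E * G (fcons (h t) u)))).
  apply: eq_esum => t _; rewrite -(IH (fun u => G (fcons (h t) u)))//.
  rewrite -esumZ//; last by move=> ?; rewrite mule_ge0 ?lee_fin ?P0.
  apply: eq_esum => w _; rewrite big_ord_recl fcons0 EFinM -muleA; congr (_ * (_ * _)).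
    by congr EFin; apply: eq_bigr => i _; rewrite fconsS.
  congr G; apply/ffunP => i; rewrite ffunE.
  by case: (unliftP ord0 i) => [j ->|->]; rewrite ?fconsS ?fcons0// ffunE.
rewrite (pq (fun v => \esum_(u in [set: {ffun 'I_n -> U}])
   ((\prod_i q (u i))%:E * G (fcons v u)))); last first.
  by move=> v; apply: esum_ge0 => *; rewrite mule_ge0 ?lee_fin ?P0.
apply: eq_esum => v _; rewrite -esumZ//; last by move=> ?; rewrite mule_ge0 ?lee_fin ?P0.
apply: eq_esum => u _; rewrite big_ord_recl fcons0 EFinM -muleA; congr (_ * (_ * _)).
by congr EFin; apply: eq_bigr => i _; rewrite fconsS.
Qed.

End Esum.

(** * Independent Poisson counts *)

Section Poisson.
Variables (R : realType) (J : finType).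
Implicit Types (r : J -> R) (v : {ffun J -> nat}) (x : J) (l : seq J).
Local Open Scope ereal_scope.

Definition delta x : {ffun J -> nat} := [ffun y => nat_of_bool (y == x)].

Definition cnt l : {ffun J -> nat} := [ffun y => count_mem y l].

Definition pois r v : R := (\prod_j poi (r j) (v j))%R.

Lemma vaddE v w x : (v + w)%R x = (v x + w x)%N.
Proof. by rewrite ffunE. Qed.

Lemma poi_ge0 (a : R) s : (0 <= a)%R -> (0 <= poi a s)%R.
Proof. by move=> a0; rewrite /poi !mulr_ge0 ?expR_ge0 ?exprn_ge0. Qed.

Lemma poiS (a : R) s : (poi a s.+1 * s.+1%:R = a * poi a s)%R.
Proof.
rewrite /poi factS natrM exprS invfM.
have h1 : (s.+1%:R != 0 :> R)%R by rewrite pnatr_eq0.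
have h2 : (s`!%:R != 0 :> R)%R by rewrite pnatr_eq0 -lt0n fact_gt0.
by move: (s.+1%:R)%R (s`!%:R)%R (a ^+ s)%R h1 h2 => u w z h1 h2; field; rewrite h1 h2.
Qed.

Lemma pois_ge0 r v : (forall x, 0 <= r x)%R -> (0 <= pois r v)%R.
Proof. by move=> r0; apply: prodr_ge0 => x _; exact: poi_ge0. Qed.

Lemma pois_delta r v x :
  (pois r (v + delta x) * (v x).+1%:R = r x * pois r v)%R.
Proof.
rewrite /pois (bigD1 x)//= [in RHS](bigD1 x)//= vaddE ffunE eqxx addn1.
rewrite mulrAC poiS -mulrA; congr (_ * (_ * _))%R; apply: eq_bigr => y yx.
by rewrite vaddE ffunE (negbTE yx) addn0.
Qed.

Lemma cnt_nil : cnt [::] = 0%R.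
Proof. by apply/ffunP => x; rewrite !ffunE. Qed.

Lemma cnt_cons x l : cnt (x :: l) = (cnt l + delta x)%R.
Proof. by apply/ffunP => y; rewrite vaddE !ffunE /= eq_sym addnC. Qed.

Lemma cnt_cat l l' : cnt (l ++ l') = (cnt l + cnt l')%R.
Proof. by apply/ffunP => y; rewrite vaddE !ffunE count_cat. Qed.

Lemma cnt_perm_eq l l' : cnt l = cnt l' -> perm_eq l l'.
Proof.
by move=> /ffunP e; apply/allP => x _ /=; move: (e x); rewrite !ffunE => ->.
Qed.

(** A word with multiplicities [v]; any other order would serve, since shuffling forgets it. *)
Definition cnt_repr v : seq J := flatten [seq nseq (v x) x | x <- enum J].

Lemma cnt_reprK v : cnt (cnt_repr v) = v.
Proof.
apply/ffunP => y; rewrite ffunE /cnt_repr count_flatten -map_comp sumnE big_map.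
rewrite big_enum /= (bigD1 y)//= count_nseq /= eqxx mul1n big1 ?addn0// => x xy.
by rewrite count_nseq /= (negbTE xy).
Qed.

Definition Epois r (G : {ffun J -> nat} -> \bar R) : \bar R :=
  \esum_(v in [set: {ffun J -> nat}]) ((pois r v)%:E * G v).

Variable r : J -> R.
Hypothesis r0 : forall x, (0 <= r x)%R.

Lemma pois_mule_ge0 v (y : \bar R) : 0 <= y -> 0 <= (pois r v)%:E * y.
Proof. by move=> y0; rewrite mule_ge0// lee_fin pois_ge0. Qed.

Lemma Epois_ge0 G : (forall v, 0 <= G v) -> 0 <= Epois r G.
Proof. by move=> G0; apply: esum_ge0 => v _; rewrite pois_mule_ge0. Qed.

Lemma le_Epois G H : (forall v, G v <= H v) -> Epois r G <= Epois r H.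
Proof. by move=> GH; apply: le_esum => v _; rewrite lee_wpmul2l// lee_fin pois_ge0. Qed.

Lemma eq_Epois G H : (forall v, G v = H v) -> Epois r G = Epois r H.
Proof. by move=> GH; apply: eq_esum => v _; rewrite GH. Qed.

Lemma EpoisD G H : (forall v, 0 <= G v) -> (forall v, 0 <= H v) ->
  Epois r (fun v => G v + H v) = Epois r G + Epois r H.
Proof.
move=> G0 H0; rewrite /Epois -esumD => [|v _|v _]; rewrite ?pois_mule_ge0//.
by apply: eq_esum => v _; rewrite ge0_muleDr.
Qed.

Lemma EpoisZ (c : R) G : (0 <= c)%R -> (forall v, 0 <= G v) ->
  Epois r (fun v => c%:E * G v) = c%:E * Epois r G.
Proof.
move=> c0 G0; rewrite /Epois -esumZ// => [|v]; last exact: pois_mule_ge0.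
by apply: eq_esum => v _; rewrite muleCA.
Qed.

Lemma Epois_sum (I : Type) (s : seq I) (P : pred I) (G : I -> {ffun J -> nat} -> \bar R) :
  (forall i v, 0 <= G i v) ->
  Epois r (fun v => \sum_(i <- s | P i) G i v) = \sum_(i <- s | P i) Epois r (G i).
Proof.
move=> G0; elim: s => [|i s IH].
  under eq_Epois do rewrite big_nil.
  by rewrite big_nil /Epois esum1// => v _; rewrite mule0.
rewrite big_cons; case: ifP => Pi; last first.
  by rewrite -IH; apply: eq_Epois => v; rewrite big_cons Pi.
rewrite -IH -EpoisD//; first by apply: eq_Epois => v; rewrite big_cons Pi.
by move=> v; apply: sume_ge0.
Qed.

(* The Stein-Chen (Mecke) identity of the Poisson law. *)
Lemma Epois_shift G x : (forall v, 0 <= G v) ->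
  Epois r (fun v => (v x)%:R%:E * G v) = (r x)%:E * Epois r (fun v => G (v + delta x)%R).
Proof.
move=> G0; rewrite -EpoisZ//.
(* Vectors with [v x = 0] contribute nothing, and adding [delta x] maps all vectors bijectively onto
   [D]. *)
pose D := [set v : {ffun J -> nat} | (0 < v x)%N].
transitivity (\esum_(v in D) ((pois r v)%:E * ((v x)%:R%:E * G v))).
  rewrite [RHS]esum_mkcond; apply: eq_esum => v _.
  case: ifPn => //; rewrite notin_setE /D /= => /negP; rewrite -eqn0Ngt => /eqP ->.
  by rewrite mul0e mule0.
rewrite (@reindex_esum _ _ _ [set: {ffun J -> nat}] D (fun v => v + delta x)%R); last first.
  split => [v _|v w _ _ /ffunP e|v vx].
  - by rewrite /D /= vaddE !ffunE eqxx addn1.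
  - by apply/ffunP => y; move: (e y); rewrite !vaddE => /addIn.
  exists [ffun y => (v y - (y == x))%N] => //.
  apply/ffunP => y; rewrite vaddE !ffunE subnK//.
  by case: eqP => // ->.
apply: eq_esum => v _; rewrite vaddE [delta x x]ffunE eqxx addn1.
by rewrite !muleA -!EFinM pois_delta (mulrC (r x)).
Qed.

Lemma vsum_eq0 v : (\sum_x v x == 0)%N = (v == 0%R).
Proof.
rewrite sum_nat_eq0; apply/forallP/eqP => [v0|-> x]; last by rewrite ffunE.
by apply/ffunP => x; rewrite ffunE; exact/eqP/v0.
Qed.

Lemma vsum_delta v x : (\sum_y (v + delta x)%R y = (\sum_y v y).+1)%N.
Proof.
under eq_bigr do rewrite vaddE.
rewrite big_split /= -addn1; congr addn; rewrite (bigD1 x)//= ffunE eqxx big1// => y yx.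
by rewrite ffunE (negbTE yx).
Qed.

(** An i.i.d. expectation over words of length [N], unnormalised: its total mass is
    [(\sum_x r x) ^+ N]. *)
Definition Eseq (N : nat) (F : seq J -> \bar R) : \bar R :=
  \sum_(t : N.-tuple J) (\prod_(x <- t) r x)%:E * F t.

Lemma Eseq_ge0 N F : (forall l, 0 <= F l) -> 0 <= Eseq N F.
Proof.
by move=> F0; apply: sume_ge0 => t _; rewrite mule_ge0// lee_fin prodr_ge0.
Qed.

Lemma Eseq0 F : Eseq 0 F = F [::].
Proof.
rewrite /Eseq (big_pred1 [tuple])/=; last by move=> t; apply/esym/eqP; exact: tuple0.
by rewrite big_nil mul1e.
Qed.

Lemma EseqS N F : (forall l, 0 <= F l) ->
  Eseq N.+1 F = \sum_x (r x)%:E * Eseq N (fun l => F (x :: l)).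
Proof.
move=> F0; rewrite /Eseq.
rewrite (reindex (fun z : J * N.-tuple J => [tuple of z.1 :: z.2])) /=; last first.
  exists (fun t : N.+1.-tuple J => (thead t, [tuple of behead t])) => [[x t] _|t _] /=.
    by rewrite theadE; congr pair; apply: val_inj.
  by rewrite [RHS]tuple_eta.
rewrite -(pair_bigA _ (fun x (t : N.-tuple J) => (\prod_(y <- x :: t) r y)%:E * F (x :: t))) /=.
apply: eq_bigr => x _; rewrite ge0_sume_distrr => [|t _].
  by apply: eq_bigr => t _; rewrite big_cons EFinM muleA.
by rewrite mule_ge0// lee_fin prodr_ge0.
Qed.

Lemma pois0 : pois r 0%R = expR (- \sum_x r x)%R.
Proof.
rewrite /pois -sumrN expR_sum; apply: eq_bigr => x _.
by rewrite ffunE /poi expr0 fact0 mulr1 divr1.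
Qed.

(** Conditioned on its total, a Poisson vector counts independent letters. In the induction the
    Mecke identity removes a letter from the vector, while [EseqS] removes the first letter of the
    word. *)
Lemma Epois_level N G : (forall v, 0 <= G v) ->
  Epois r (fun v => if (\sum_x v x == N)%N then G v else 0) =
  (expR (- \sum_x r x) / N`!%:R)%:E * Eseq N (G \o cnt).
Proof.
elim: N G => [|N IH] G G0.
  rewrite Eseq0 /= cnt_nil fact0 divr1 -pois0.
  rewrite -(@esum_set1 _ _ 0%R (fun v => (pois r v)%:E * G v)) ?pois_mule_ge0//.
  rewrite esum_mkcond; apply: eq_esum => v _; rewrite vsum_eq0.
  have -> : (v \in [set 0%R]) = (v == 0%R) by apply/idP/eqP; rewrite inE.
  by case: ifP => //; rewrite mule0.
have if0 (b : bool) (y : \bar R) : 0 <= y -> 0 <= if b then y else 0 by case: b.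
have N0 : (N.+1%:R != 0 :> R)%R by rewrite pnatr_eq0.
(* On this level the counts sum to [N.+1], so averaging with weights [v x / N.+1] changes nothing
   and creates the factor [v x] that the Mecke identity consumes. *)
transitivity (Epois r (fun v => (N.+1%:R^-1)%:E *
    \sum_x (v x)%:R%:E * if (\sum_x v x == N.+1)%N then G v else 0)).
  apply: eq_Epois => v; case: ifPn => [/eqP vN|_]; last first.
    by rewrite big1 ?mule0// => x _; rewrite mule0.
  rewrite -ge0_sume_distrl => [|x _]; last by rewrite lee_fin.
  by rewrite sumEFin -natr_sum vN muleA -EFinM mulVf// mul1e.
rewrite EpoisZ ?invr_ge0// => [|v]; last first.
  by apply: sume_ge0 => x _; rewrite mule_ge0// ?if0// lee_fin.
rewrite Epois_sum => [|x v]; last by rewrite mule_ge0// ?if0// lee_fin.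
rewrite EseqS => [|l]; last exact: G0.
rewrite factS natrM invfM mulrCA EFinM -muleA; congr (_ * _).
rewrite ge0_sume_distrr => [|x _]; last first.
  by rewrite mule_ge0 ?lee_fin// Eseq_ge0// => l; exact: G0.
apply: eq_bigr => x _; rewrite Epois_shift => [|v]; last exact: if0.
rewrite muleCA; congr (_ * _).
rewrite (_ : (fun l => _) = (fun v => G (v + delta x)%R) \o cnt); last first.
  by apply/funext => l /=; rewrite cnt_cons.
rewrite -IH//; apply: eq_Epois => v; by rewrite vsum_delta eqSS.
Qed.

Lemma Epois_seq G : (forall v, 0 <= G v) ->
  Epois r G = \esum_(N in [set: nat])
    (expR (- \sum_x r x) / N`!%:R)%:E * Eseq N (G \o cnt).
Proof.
move=> G0; under [RHS]eq_esum do rewrite -Epois_level//.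
rewrite /Epois exchange_esum => [|N v]; last by rewrite pois_mule_ge0//; case: ifP.
apply: eq_esum => v _.
pose f N := (pois r v)%:E * (if (\sum_x v x == N)%N then G v else 0).
transitivity (\esum_(N in [set (\sum_x v x)%N]) f N).
  by rewrite esum_set1 /f ?eqxx// pois_mule_ge0.
rewrite esum_mkcond; apply: eq_esum => N _; rewrite /f.
case: ifPn; rewrite ?inE // => /negP; rewrite inE /= => Nv.
by case: eqP => [e|]; [case: Nv|rewrite mule0].
Qed.

End Poisson.

(** * Words of Poisson length, superposition and Poissonised samples *)

Section Poissonization.
Variable R : realType.
Local Open Scope ereal_scope.

Lemma esum_poi (a : R) : (0 <= a)%R -> \esum_(N in [set: nat]) (poi a N)%:E = 1.
Proof.
(* Rate 0 is the point mass at 0, through [0 ^+ 0 = 1]; a positive rate gives the Poisson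
   probability measure. *)
rewrite le_eqVlt => /orP[/eqP <-|a0].
  rewrite -(@esum_set1 _ _ 0%N (fun _ => 1))// [RHS]esum_mkcond; apply: eq_esum => N _.
  rewrite /poi oppr0 expR0 mul1r; case: N => [|N].
    by rewrite expr0 fact0 divr1 mem_set.
  by rewrite expr0n mul0r memNset.
have : poisson_prob a 0%N [set: nat] = 1 := probability_setT (poisson_prob a 0%N).
rewrite /poisson_prob a0 => <-.
apply: eq_esum => N _; rewrite /poi /poisson_pmf a0; congr EFin.
by rewrite mulrAC mulrC mulrA mulrAC.
Qed.

Lemma Eseq_const (J : finType) (r : J -> R) N : (forall x, 0 <= r x)%R ->
  Eseq r N (fun => 1) = ((\sum_x r x) ^+ N)%:E.
Proof.
move=> r0; elim: N => [|N IH]; first by rewrite Eseq0 expr0.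
rewrite EseqS// IH exprS EFinM -sumEFin ge0_sume_distrl// => x _.
by rewrite lee_fin.
Qed.

Lemma Epois_const (J : finType) (r : J -> R) : (forall x, 0 <= r x)%R ->
  Epois r (fun => 1) = 1.
Proof.
move=> r0; rewrite Epois_seq// -[RHS](@esum_poi (\sum_x r x)%R) ?sumr_ge0//.
apply: eq_esum => N _; rewrite (_ : Eseq r N _ = ((\sum_x r x) ^+ N)%:E); last exact: Eseq_const.
by rewrite -EFinM /poi mulrAC.
Qed.

Definition vmap (A B : finType) (f : A -> B) (u : {ffun A -> nat}) : {ffun B -> nat} :=
  [ffun b => (\sum_(a | f a == b) u a)%N].

Lemma vmap_cnt (A B : finType) (f : A -> B) (l : seq A) :
  vmap f (cnt l) = cnt (map f l).
Proof.
apply/ffunP => b; rewrite !ffunE.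
elim: l => [|a l IH] /=.
  by rewrite big1// => a _; rewrite ffunE.
rewrite -IH cnt_cons; under eq_bigr do rewrite vaddE.
rewrite big_split /= addnC; congr addn.
case: (boolP (f a == b)) => [e|ne].
  rewrite (bigD1 a)//= ffunE eqxx big1// => x /andP[_ /negbTE xa].
  by rewrite ffunE xa.
rewrite big1// => x fx; rewrite ffunE; case: eqP => // xa.
by rewrite -xa fx in ne.
Qed.

Lemma Eseq_map (A B : finType) (f : A -> B) (r : A -> R) N (F : seq B -> \bar R) :
  (forall a, 0 <= r a)%R -> (forall l, 0 <= F l) ->
  Eseq r N (F \o map f) = Eseq (fun b => \sum_(a | f a == b) r a)%R N F.
Proof.
move=> r0; have r0' b : (0 <= \sum_(a | f a == b) r a)%R by apply: sumr_ge0.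
elim: N F => [|N IH] F F0; first by rewrite !Eseq0.
rewrite !EseqS// => [|l]; last exact: F0.
rewrite (partition_big f xpredT)//=; apply: eq_bigr => b _.
rewrite -sumEFin ge0_sume_distrl => [|a _]; last by rewrite lee_fin.
by apply: eq_bigr => a /eqP <-; rewrite -IH.
Qed.

(** Superposition of Poisson variables: relabelling the letters of a word by [f] adds up the rates
    in each fibre and transforms the counts by [vmap]. *)
Lemma Epois_vmap (A B : finType) (f : A -> B) (r : A -> R) (G : {ffun B -> nat} -> \bar R) :
  (forall a, 0 <= r a)%R -> (forall v, 0 <= G v) ->
  Epois r (G \o vmap f) = Epois (fun b => \sum_(a | f a == b) r a)%R G.
Proof.
move=> r0 G0; have r0' b : (0 <= \sum_(a | f a == b) r a)%R by apply: sumr_ge0.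
rewrite !Epois_seq// => [|v]; last exact: G0.
apply: eq_esum => N _; congr ((expR (- _) / _)%:E * _).
  by rewrite (partition_big f xpredT).
rewrite -(Eseq_map f N (F := G \o @cnt B))// => [|l]; last exact: G0.
by congr Eseq; apply/funext => l /=; rewrite vmap_cnt.
Qed.

(* A Poisson number of i.i.d. letters has independent Poisson letter counts. *)
Lemma esum_poi_seq (J : finType) (r : J -> R) (G : {ffun J -> nat} -> \bar R) :
  (forall x, 0 <= r x)%R -> (forall v, 0 <= G v) ->
  \esum_(l in [set: seq J])
    ((expR (- \sum_x r x) * (\prod_(x <- l) r x) / (size l)`!%:R)%:E * G (cnt l)) =
  Epois r G.
Proof.
move=> r0 G0; rewrite Epois_seq// esum_seq; last first.
  by move=> l; rewrite mule_ge0// lee_fin !mulr_ge0 ?expR_ge0 ?prodr_ge0 ?invr_ge0.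
apply: eq_esum => N _; rewrite /Eseq ge0_sume_distrr => [|t _]; last first.
  by rewrite mule_ge0 ?lee_fin ?prodr_ge0 /=.
apply: eq_bigr => t _; rewrite size_tuple muleA -EFinM.
by congr (_%:E * _); rewrite mulrAC.
Qed.

Lemma Eseq_ffun (J : finType) (r : J -> R) N (F : seq J -> \bar R) :
  Eseq r N F = \sum_(xs : {ffun 'I_N -> J})
    (\prod_(i < N) r (xs i))%:E * F [seq xs i | i <- enum 'I_N].
Proof.
rewrite /Eseq.
rewrite (reindex (fun xs : {ffun 'I_N -> J} => [tuple xs i | i < N])) /=; last first.
  exists (fun t : N.-tuple J => [ffun i => tnth t i]) => [xs _|t _].
    by apply/ffunP => i; rewrite ffunE tnth_mktuple.
  by apply: eq_from_tnth => i; rewrite tnth_mktuple ffunE.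
by apply: eq_bigr => xs _; rewrite big_map big_enum.
Qed.

(** The factor [n ^+ N] of the Poisson mass is distributed over the [N] letters, which gives them
    the weights [n * p x], of sum [n]. *)
Lemma esum_poi_ffun (J : finType) (n : R) (p : J -> R) (G : {ffun J -> nat} -> \bar R) :
  (0 <= n)%R -> (forall x, 0 <= p x)%R -> (\sum_x p x = 1)%R -> (forall v, 0 <= G v) ->
  \esum_(N in [set: nat]) ((poi n N)%:E * \sum_(xs : {ffun 'I_N -> J})
    (\prod_(i < N) p (xs i))%:E * G (cnt [seq xs i | i <- enum 'I_N])) =
  Epois (fun x => n * p x)%R G.
Proof.
move=> n0 p0 p1 G0; have np0 x : (0 <= n * p x)%R by rewrite mulr_ge0.
rewrite Epois_seq//; apply: eq_esum => N _.
rewrite Eseq_ffun -mulr_sumr p1 mulr1 /poi mulrAC EFinM -muleA; congr (_ * _).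
rewrite ge0_sume_distrr => [|xs _]; last by rewrite mule_ge0// lee_fin prodr_ge0.
apply: eq_bigr => xs _; rewrite big_split /= prodr_const card_ord.
by rewrite [in RHS]EFinM muleA.
Qed.

End Poissonization.

(** * Shuffled output as a function of Poisson counts *)

Section Shuffle.
Variable R : realType.

Section ShuffleProb.
Variable T : eqType.
Implicit Types (s t : seq T) (S : set (seq T)).

Lemma shuffle_prob_ge0 s S : 0 <= shuffle_prob R s S.
Proof. by rewrite /shuffle_prob divr_ge0// sumr_ge0. Qed.

Lemma perm_permute s (sigma : 'S_(size s)) : perm_eq (permute sigma) s.
Proof. by apply/(@tuple_permP _ _ _ (in_tuple s)); exists sigma. Qed.

(** The average is over a constant. This applies to the analyser, whose verdict depends only on
    multiplicities. *)
Lemma shuffle_prob_det s S (b : bool) :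
  (forall t, perm_eq t s -> S t <-> b) -> shuffle_prob R s S = b%:R.
Proof.
move=> Sb; rewrite /shuffle_prob.
under eq_bigr => sigma _.
  rewrite (_ : `[< _ >] = b); last by apply/asboolP/idP => /Sb; apply; exact: perm_permute.
  over.
by rewrite sumr_const card_Sn -[X in X / _]mulr_natr mulfK.
Qed.

Lemma shuffle_prob_le1 s S : shuffle_prob R s S <= 1.
Proof.
rewrite -[leRHS](@shuffle_prob_det s setT true)// /shuffle_prob ler_wpM2r ?invr_ge0//.
apply: ler_sum => sigma _; rewrite ler_nat.
by rewrite (_ : `[< [set: seq T] _ >] = true) ?leq_b1//; exact: asboolT.
Qed.

(** Replacing [size s] by a variable lets two lists of equal length be compared over the same group
    ['S_n]. *)
Lemma shuffle_prob_tuple n (t : n.-tuple T) S :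
  shuffle_prob R t S =
  (\sum_(sigma : 'S_n) `[< S [seq tnth t (sigma i) | i <- enum 'I_n] >]%:R) / n`!%:R.
Proof.
case: t => s sn; move: (sn); move/eqP: sn => <- sn /=.
by rewrite /shuffle_prob; congr (_ / _); apply: eq_bigr => sigma _;
  rewrite (_ : Tuple sn = in_tuple s)//; exact: val_inj.
Qed.

Lemma shuffle_prob_perm s t S : perm_eq s t -> shuffle_prob R s S = shuffle_prob R t S.
Proof.
move=> /(@tuple_permP _ _ _ (in_tuple t)) [p ->].
rewrite shuffle_prob_tuple /shuffle_prob; congr (_ / _).
(* Right translation by [p] preserves the uniform law on permutations. *)
rewrite [RHS](reindex_inj (mulIg p)) /=; apply: eq_bigr => sigma _.
rewrite /permute; congr ((`[< S _ >] : bool)%:R).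
by apply: eq_map => i; rewrite tnth_mktuple permM.
Qed.

End ShuffleProb.

Section Representation.
Variables (k : nat).
Local Open Scope ereal_scope.

Lemma cnt_flatten (J : finType) (ss : seq (seq J)) :
  cnt (flatten ss) = (\sum_(s <- ss) cnt s)%R.
Proof.
elim: ss => [|s ss IH]; first by rewrite big_nil cnt_nil.
by rewrite big_cons /= cnt_cat IH.
Qed.

(** The deterministic messages [(j, 1{x = j})]; the random ones are counted in [noise_cnt]. *)
Definition base_cnt m (xs : {ffun 'I_m -> 'I_k}) : {ffun msg k -> nat} :=
  (\sum_i \sum_j delta (j, xs i == j))%R.

Definition noise_cnt m (u : {ffun 'I_m -> {ffun 'I_k -> {ffun bool -> nat}}}) :
  {ffun msg k -> nat} := [ffun y => (\sum_i u i y.1 y.2)%N].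

Lemma cnt_all_msgs m (xs : {ffun 'I_m -> 'I_k}) (w : {ffun 'I_m -> {ffun 'I_k -> seq bool}}) :
  cnt (all_msgs xs w) =
  (noise_cnt [ffun i => [ffun j => cnt (w i j)]] + base_cnt xs)%R.
Proof.
rewrite /all_msgs cnt_flatten big_map big_enum /=.
under eq_bigr => i _.
  rewrite /rand_msgs cnt_flatten big_map big_enum /=.
  under eq_bigr do rewrite cnt_cons.
  rewrite big_split /=; over.
rewrite big_split /=; congr (_ + _)%R.
apply/ffunP => -[j b]; rewrite sum_ffunE ffunE /=; apply: eq_bigr => i _.
rewrite sum_ffunE (bigD1 j)//= big1 ?addr0 => [|j' j'j].
  by rewrite !ffunE count_map; apply: eq_count => b'; rewrite /= xpair_eqE eqxx.
rewrite ffunE count_map (@eq_count _ _ pred0) ?count_pred0// => b'.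
by rewrite /= xpair_eqE (negbTE j'j).
Qed.

(** Poisson splitting: both bit values get weight [a / 2], the weights sum to [a], and a word of
    length [s] weighs [(a / 2) ^+ s]. *)
Lemma esum_bits (a : R) (g : {ffun bool -> nat} -> \bar R) :
  (0 <= a)%R -> (forall u, 0 <= g u) ->
  \esum_(l in [set: seq bool]) ((poi a (size l) * 2^-1 ^+ size l)%:E * g (cnt l)) =
  \esum_(u in [set: {ffun bool -> nat}]) ((pois (fun => a / 2)%R u)%:E * g u).
Proof.
move=> a0 g0; rewrite -[RHS]esum_poi_seq// => [|_]; last by rewrite divr_ge0.
apply: eq_esum => l _; congr (_%:E * _).
rewrite sumr_const card_bool mulr2n -splitr big_const_seq count_predT iter_mulr_1 exprMn /poi.
by rewrite -!mulrA; congr (_ * (_ * _))%R; rewrite mulrC.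
Qed.

(** Bits are first replaced by their counts for each user and coordinate; superposition over the [m]
    users then multiplies the rate [a / 2] by [m]. *)
Lemma esum_coins m (a : R) (G : {ffun msg k -> nat} -> \bar R) :
  (0 <= a)%R -> (forall v, 0 <= G v) ->
  \esum_(w in [set: {ffun 'I_m -> {ffun 'I_k -> seq bool}}])
    ((\prod_i \prod_j (poi a (size (w i j)) * 2^-1 ^+ size (w i j)))%:E *
     G (noise_cnt [ffun i => [ffun j => cnt (w i j)]])) =
  Epois (fun => m%:R * (a / 2))%R G.
Proof.
move=> a0 G0.
have a20 : (0 <= a / 2)%R by rewrite divr_ge0.
pose p (l : seq bool) : R := (poi a (size l) * 2^-1 ^+ size l)%R.
have p0 l : (0 <= p l)%R by rewrite /p mulr_ge0 ?poi_ge0.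
pose q (u : {ffun bool -> nat}) : R := pois (fun => a / 2)%R u.
have q0 u : (0 <= q u)%R by rewrite /q pois_ge0.
transitivity (\esum_(U in [set: {ffun 'I_m -> {ffun 'I_k -> {ffun bool -> nat}}}])
    ((\prod_i \prod_j q (U i j))%:E * G (noise_cnt U))).
  rewrite -[RHS](esum_prod_push (p := fun l : {ffun 'I_k -> seq bool} => (\prod_j p (l j))%R)
    (q := fun u : {ffun 'I_k -> {ffun bool -> nat}} => (\prod_j q (u j))%R)
    (h := fun l : {ffun 'I_k -> seq bool} => [ffun j => cnt (l j)])
    (G := fun U => G (noise_cnt U)))//= => [l|u|g g0].
  - exact: prodr_ge0.
  - exact: prodr_ge0.
  - by apply: esum_prod_push => // g' g'0; exact: esum_bits.
(* The index (user, coordinate, bit) is flattened by [e], and [f] forgets the user, so that each of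
   its fibres has [m] elements. *)
pose f (z : 'I_m * 'I_k * bool) : msg k := (z.1.2, z.2).
pose e (V : {ffun 'I_m * 'I_k * bool -> nat}) :=
  [ffun i => [ffun j => [ffun b => V (i, j, b)]]].
rewrite (esum_bij (e := e)); last first.
  exists (fun U : {ffun 'I_m -> {ffun 'I_k -> {ffun bool -> nat}}} =>
    [ffun z => U z.1.1 z.1.2 z.2]) => [V|U].
    by apply/ffunP => -[[i j] b]; rewrite !ffunE.
  by do 3 (apply/ffunP => ?; rewrite ffunE); rewrite !ffunE.
rewrite (_ : (fun => m%:R * (a / 2))%R =
    (fun y => \sum_(z | f z == y) (fun => a / 2) z)%R); last first.
  apply/funext => -[j b] /=.
  rewrite (eq_bigl (fun z : 'I_m * 'I_k * bool => (z.1.2 == j) && (z.2 == b))); last first.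
    by move=> z; rewrite /f xpair_eqE.
  rewrite (reindex_onto (fun i => (i, j, b)) (fun z => z.1.1)) /= => [|[[i j'] b'] /=]; last first.
    by move=> /andP[/eqP -> /eqP ->].
  under eq_bigl do rewrite !eqxx.
  by rewrite sumr_const card_ord mulr_natl.
rewrite -Epois_vmap//; apply: eq_esum => V _; congr (_%:E * G _).
  transitivity (\prod_i \prod_j \prod_b poi (a / 2) (V (i, j, b)))%R; last first.
    by rewrite pair_bigA pair_bigA; apply: eq_bigr => -[[i j] b].
  by do 2 (apply: eq_bigr => ? _); rewrite /q /pois; apply: eq_bigr => b _; rewrite !ffunE.
apply/ffunP => -[j b]; rewrite !ffunE /=.
rewrite (eq_bigl (fun z : 'I_m * 'I_k * bool => (z.1.2 == j) && (z.2 == b))); last first.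
  by move=> z; rewrite /f xpair_eqE.
rewrite (reindex_onto (fun i => (i, j, b)) (fun z => z.1.1)) /= => [|[[i j'] b'] /=]; last first.
  by move=> /andP[/eqP -> /eqP ->].
under [RHS]eq_bigl do rewrite !eqxx.
by apply: eq_bigr => i _; rewrite !ffunE.
Qed.

(** The shuffle sees the messages only through their multiplicities: Poisson noise plus a shift that
    carries all the dependence on the data. *)
Lemma shuffler_probE m N (lam : R) (xs : {ffun 'I_m -> 'I_k}) (S : set (seq (msg k))) :
  (0 <= lam)%R ->
  shuffler_prob N lam xs S =
  Epois (fun => m%:R * (lam / N%:R / 2))%R
    (fun v => (shuffle_prob R (cnt_repr (v + base_cnt xs)%R) S)%:E).
Proof.
move=> lam0; rewrite -esum_coins ?divr_ge0//; last by move=> v; rewrite lee_fin shuffle_prob_ge0.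
apply: eq_esum => w _; rewrite EFinM; congr (_ * _%:E).
apply: shuffle_prob_perm; apply: cnt_perm_eq.
by rewrite cnt_reprK cnt_all_msgs.
Qed.

End Representation.
End Shuffle.

(** * Privacy *)

Section Tails.
Variables (R : realType) (J : finType) (r : J -> R).
Hypothesis r0 : forall x, 0 <= r x.
Implicit Types (v : {ffun J -> nat}) (x : J).

Lemma poi_tilt (a t : R) s :
  poi a s * expR (t * s%:R) = expR (a * (expR t - 1)) * poi (a * expR t) s.
Proof.
rewrite expRM_natr /poi exprMn mulrBr mulr1 expRD.
have := expRxMexpNx_1 (a * expR t).
move: (expR (a * _)) (expR (- (a * _))) (expR (- a)) => z z' w zz'.
rewrite -[LHS]mul1r -zz'.
by move: (a ^+ s) (_ ^-1) => p i; ring.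
Qed.

(** Tilting coordinate [x] turns the law into a Poisson law with rates [r'], of total mass 1; the
    normalising factor is the moment generating function. *)
Lemma Epois_expR x t :
  Epois r (fun v => (expR (t * (v x)%:R))%:E) = (expR (r x * (expR t - 1)))%:E.
Proof.
pose r' y := if y == x then r x * expR t else r y.
have r'0 y : 0 <= r' y by rewrite /r'; case: ifP; rewrite ?mulr_ge0 ?expR_ge0.
rewrite -[RHS]mule1 -(Epois_const r'0) /Epois -esumZ ?expR_ge0// => [|v]; last first.
  by rewrite mule1 lee_fin pois_ge0.
apply: eq_esum => v _; rewrite mule1 -!EFinM; congr EFin.
rewrite /pois (bigD1 x)//= [in RHS](bigD1 x)//= mulrAC poi_tilt -mulrA /r' eqxx.
by congr (_ * (_ * _)); apply: eq_bigr => y /negbTE ->.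
Qed.

Definition ind (b : bool) : \bar R := (b%:R)%:E.

Lemma ind_ge0 b : (0 <= ind b)%E. Proof. by rewrite lee_fin ler0n. Qed.

(** Exponential Markov inequality. The sign of [t] is free, so both tails are covered. *)
Lemma Epois_chernoff x (t c : R) (P : {ffun J -> nat} -> bool) :
  (forall v, P v -> 0 <= t * (v x)%:R + c) ->
  (Epois r (fun v => ind (P v)) <= (expR (r x * (expR t - 1) + c))%:E)%E.
Proof.
move=> Pt; apply: (@le_trans _ _ (Epois r (fun v => (expR c)%:E * (expR (t * (v x)%:R))%:E)%E)).
  apply: le_Epois => // v; rewrite /ind; case: (boolP (P v)) => [/Pt tc|_] /=.
    by rewrite -EFinM -expRD lee_fin -[leLHS]expR0 ler_expR (addrC c). 
  by rewrite mule_ge0// lee_fin expR_ge0.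
rewrite EpoisZ ?expR_ge0//.
by rewrite Epois_expR -EFinM -expRD addrC.
Qed.

(** The successor is there because the Mecke shift adds one unit to the count; [8^-1 <= L] pays for
    that unit. *)
Lemma Epois_upper_tail (e L : R) x : 0 < e -> e <= 1 -> 8^-1 <= L -> 64 * L / e ^+ 2 <= r x ->
  (Epois r (fun v => ind (expR (e / 2) * r x < (v x).+1%:R)%R) <= (expR (- L))%:E)%E.
Proof.
move=> e0 e1 L0; rewrite ler_pdivrMr ?exprn_gt0// => rL.
(* With this [t] the exponent is at most [- r x * e ^+ 2 / 32 + e / 8], hence at most
   [- 2 * L + 8^-1]. *)
apply: (le_trans (Epois_chernoff (x := x) (t := e / 8)
    (c := e / 8 * (1 - expR (e / 2) * r x)) _)) => [v /ltW h|].
  rewrite -mulrDr mulr_ge0 ?divr_ge0 ?(ltW e0)//.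
  by move: h; rewrite -natr1; lra.
rewrite lee_fin ler_expR.
have h1 : 1 + e / 2 <= expR (e / 2) := expR_ge1Dx _.
(* From [1 - t <= expR (- t)] and [1 <= (1 - t) * (1 + t + 2 * t ^+ 2)] for small [t]. *)
have h2 : expR (e / 8) <= 1 + e / 8 + 2 * (e / 8) ^+ 2.
  have t0 : 0 < e / 8 by rewrite divr_gt0.
  have t1 : e / 8 <= 8^-1 by lra.
  have := expR_ge1Dx (- (e / 8)); have := expRxMexpNx_1 (e / 8).
  move: (e / 8) (expR_gt0 (e / 8)) t0 t1 => t; move: (expR t) (expR (- t)).
  move=> a b a0 t0 t1 ab b1.
  have h : a * (1 - t) <= a * b by apply: ler_wpM2l; lra.
  have t2 : 0 <= t ^+ 2 * (1 - 2 * t) by rewrite mulr_ge0 ?exprn_ge0 ?(ltW t0)//; lra.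
  rewrite -(@ler_pM2l _ (1 - t)); last by lra.
  by rewrite mulrC (le_trans h)// ab; lra.
have h3 : r x * (expR (e / 8) - 1) <= r x * (e / 8 + 2 * (e / 8) ^+ 2).
  by rewrite ler_wpM2l//; lra.
have h4 : e / 8 * ((1 + e / 2) * r x) <= e / 8 * (expR (e / 2) * r x).
  by rewrite ler_wpM2l ?divr_ge0 ?(ltW e0)// ler_wpM2r.
lra.
Qed.

Lemma Epois_lower_tail (e L : R) x : 0 < e -> e <= 1 -> 64 * L / e ^+ 2 <= r x ->
  (Epois r (fun v => ind ((v x)%:R < expR (- (e / 2)) * r x)%R) <= (expR (- L))%:E)%E.
Proof.
move=> e0 e1; rewrite ler_pdivrMr ?exprn_gt0// => rL.
(* Here the exponent is at most [- r x * e ^+ 2 / 64], the source of the constant 64. *)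
apply: (le_trans (Epois_chernoff (x := x) (t := - (e / 8))
    (c := e / 8 * (expR (- (e / 2)) * r x)) _)) => [v /ltW h|].
  by rewrite mulNr addrC -mulrBr mulr_ge0 ?divr_ge0 ?(ltW e0)// subr_ge0.
rewrite lee_fin ler_expR.
have inv1 (y : R) : 0 < y -> y <= 1 -> expR (- y) <= 1 - y + y ^+ 2.
  move=> y0 y1; have := expR_ge1Dx y; have := expRxMexpNx_1 y.
  have := expR_gt0 (- y); move: (expR (- y)) (expR y) => a b a0 ab b1.
  have h : a * (1 + y) <= a * b by apply: ler_wpM2l; lra.
  have y3 : 0 <= y ^+ 2 * y by rewrite mulr_ge0 ?exprn_ge0 ?(ltW y0).
  rewrite -(@ler_pM2r _ (1 + y)); last by lra.
  by rewrite (le_trans h)// mulrC ab; lra.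
have h1 : expR (- (e / 2)) <= 1 - e / 4.
  have /inv1 h : 0 < e / 2 by rewrite divr_gt0.
  have e2 : 0 <= e * (1 - e) by rewrite mulr_ge0; lra.
  by have {h} := h ltac:(lra); lra.
have h2 : expR (- (e / 8)) <= 1 - e / 8 + (e / 8) ^+ 2.
  by apply: inv1; lra.
have h3 : r x * (expR (- (e / 8)) - 1) <= r x * (- (e / 8) + (e / 8) ^+ 2).
  by rewrite ler_wpM2l//; lra.
have h4 : e / 8 * (expR (- (e / 2)) * r x) <= e / 8 * ((1 - e / 4) * r x).
  by rewrite ler_wpM2l ?divr_ge0 ?(ltW e0)// ler_wpM2r.
lra.
Qed.

End Tails.

(** * Comparison of a Poisson vector under two different shifts *)

Section TwoShifts.
Variables (R : realType) (J : finType) (rho e L : R).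
Hypotheses (e0 : 0 < e) (e1 : e <= 1) (L0 : 8^-1 <= L) (rho0 : 0 < rho).
Hypothesis rhoL : 64 * L / e ^+ 2 <= rho.
Implicit Types (v : {ffun J -> nat}) (g : {ffun J -> nat} -> R).

Let r : J -> R := fun => rho.
Let r0 x : 0 <= r x. Proof. exact: ltW. Qed.
Local Open Scope ereal_scope.

(** The Mecke identity at [a], then at [b]; as [a != b], the unit added at [a] leaves the weight
    [v b] unchanged. *)
Lemma Epois_shift2 (a b : J) (G : {ffun J -> nat} -> \bar R) :
  a != b -> (forall v, 0 <= G v) ->
  Epois r (fun v => (v a * v b)%:R%:E * G v) =
  (rho ^+ 2)%:E * Epois r (fun v => G (v + (delta a + delta b))%R).
Proof.
move=> ab G0.
transitivity (Epois r (fun v => (v a)%:R%:E * ((v b)%:R%:E * G v))).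
  by apply: eq_Epois => v; rewrite muleA natrM EFinM.
rewrite Epois_shift => // [|v]; last by rewrite mule_ge0// lee_fin.
rewrite expr2 EFinM -muleA; congr (_ * _).
transitivity (Epois r (fun v => (v b)%:R%:E * G (v + delta a)%R)).
  by apply: eq_Epois => v; rewrite vaddE ffunE eq_sym (negbTE ab) addn0.
rewrite Epois_shift//; congr (_ * _).
by apply: eq_Epois => v; rewrite -addrA (addrC (delta b)).
Qed.

Lemma Epois_two_shifts (a b c d : J) g : a != b -> c != d ->
  (forall v, 0 <= g v <= 1)%R ->
  Epois r (fun v => (g (v + (delta a + delta b)))%:E)%R <=
  (expR (2 * e))%:E * Epois r (fun v => (g (v + (delta c + delta d)))%:E)%R +
  (4 * expR (- L))%:E.
Proof.
move=> ab cd g01.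
have g0 v : 0 <= (g v)%:E by case/andP: (g01 v).
(* The thresholds satisfy [ub * ub = expR (2 * e) * (lb * lb)], which is the factor allowed between
   [v a * v b] and [v c * v d]. *)
pose ub := (expR (e / 2) * rho)%R; pose lb := (expR (- (e / 2)) * rho)%R.
pose bad v : \bar R := ind R (ub < (v a)%:R)%R + ind R (ub < (v b)%:R)%R +
  ind R ((v c)%:R < lb)%R + ind R ((v d)%:R < lb)%R.
have bad0 v : 0 <= bad v by rewrite !adde_ge0 ?ind_ge0.
have hb (b1 b2 b3 b4 : bool) : [|| b1, b2, b3 | b4] ->
    1 <= ind R b1 + ind R b2 + ind R b3 + ind R b4.
  by case: b1; case: b2; case: b3; case: b4 => //= _; rewrite /ind -!EFinD lee_fin /=; lra.
have pw v : (v a * v b)%:R%:E * (g v)%:E <=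
    (expR (2 * e))%:E * ((v c * v d)%:R%:E * (g v)%:E) + (v a * v b)%:R%:E * bad v.
  have [va|va] := ltP ub (v a)%:R%R; last have [vb|vb] := ltP ub (v b)%:R%R; last
    have [vc|vc] := ltP (v c)%:R%R lb; last have [vd|vd] := ltP (v d)%:R%R lb.
  1-4: rewrite (@le_trans _ _ ((v a * v b)%:R%:E * bad v))// ?leeDr//; last
    by rewrite !mule_ge0 ?lee_fin ?expR_ge0//; case/andP: (g01 v).
  1-4: apply: lee_wpmul2l; first by rewrite lee_fin.
  1-4: apply: (@le_trans _ _ 1); first by rewrite lee_fin; case/andP: (g01 v).
  1-4: by apply: hb; rewrite ?va ?vb ?vc ?vd ?orbT.
  rewrite (@le_trans _ _ ((expR (2 * e))%:E * ((v c * v d)%:R%:E * (g v)%:E)))//; last first.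
    by rewrite leeDl// mule_ge0// lee_fin.
  rewrite muleA lee_wpmul2r// -EFinM lee_fin !natrM.
  rewrite (@le_trans _ _ (ub * ub)%R)//; first by rewrite ler_pM.
  have -> : (ub * ub = expR (2 * e) * (lb * lb))%R.
    rewrite /ub /lb; have -> : (2 * e = e / 2 + e / 2 + (e / 2 + e / 2))%R by lra.
    rewrite !expRD; have := expRxMexpNx_1 (e / 2).
    move: (expR (e / 2)) (expR (- (e / 2))) => x y xy.
    have -> : (x * x * (x * x) * (y * rho * (y * rho)) =
      (x * y) ^+ 2 * (x * rho * (x * rho)))%R by ring.
    by rewrite xy expr1n mul1r.
  by rewrite ler_wpM2l ?expR_ge0// ler_pM// mulr_ge0 ?expR_ge0 ?ltW.
have rho2 : (0 < rho ^+ 2)%R by rewrite exprn_gt0.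
rewrite -(@lee_pmul2l _ (rho ^+ 2)%:E)//.
rewrite -(Epois_shift2 (G := fun v => (g v)%:E))// ge0_muleDr; last 2 first.
- by rewrite mule_ge0 ?lee_fin ?expR_ge0// Epois_ge0.
- by rewrite lee_fin mulr_ge0 ?expR_ge0.
rewrite muleCA -(Epois_shift2 (G := fun v => (g v)%:E))//.
apply: (le_trans (le_Epois r0 pw)).
rewrite EpoisD// => [|v|v]; last 2 first.
- by rewrite !mule_ge0 ?g0// lee_fin ?expR_ge0.
- by rewrite mule_ge0 ?lee_fin.
rewrite EpoisZ ?expR_ge0// => [|v]; last by rewrite mule_ge0 ?g0// lee_fin.
rewrite leeD2l// Epois_shift2//; apply: lee_wpmul2l; first by rewrite lee_fin ltW.
(* Undoing the weight [v a * v b] shifts the argument of [bad]: the counts at [a] and [b] gain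
   exactly one, and those at [c] and [d] do not decrease, so the lower-tail events only shrink. *)
pose bad1 v : \bar R := ind R (ub < (v a).+1%:R)%R + ind R (ub < (v b).+1%:R)%R +
  ind R ((v c)%:R < lb)%R + ind R ((v d)%:R < lb)%R.
have ind_mono (b1 b2 : bool) : (b1 -> b2) -> ind R b1 <= ind R b2.
  by case: b1 b2 => -[] // h; rewrite ?(h isT)// /ind lee_fin.
apply: (@le_trans _ _ (Epois r bad1)).
  apply: le_Epois => // v; rewrite /bad /bad1 !leeD//; apply: ind_mono.
  - by rewrite !vaddE !ffunE eqxx (negbTE ab) addn0 addn1.
  - by rewrite !vaddE !ffunE eqxx eq_sym (negbTE ab) add0n addn1.
  - by apply: le_lt_trans; rewrite ler_nat vaddE leq_addr.
  - by apply: le_lt_trans; rewrite ler_nat vaddE leq_addr.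
rewrite !EpoisD; [|by move=> v; rewrite ?adde_ge0 ?ind_ge0..].
rewrite (_ : (4 * _)%:E = (expR (- L))%:E + (expR (- L))%:E + (expR (- L))%:E + (expR (- L))%:E).
  have up x := Epois_upper_tail r0 (x := x) e0 e1 L0 rhoL.
  have lo x := Epois_lower_tail r0 (x := x) e0 e1 rhoL.
  exact: leeD (leeD (leeD (up a) (up b)) (lo c)) (lo d).
by rewrite -!EFinD; congr EFin; lra.
Qed.

End TwoShifts.

(** * The noise level and robust privacy of the protocol *)

Section Privacy.
Variable R : realType.

(** With [m = gam * N] honest users each count has rate [gam * lambda / 2], which must reach
    [64 * (gam * ln del^-1) / e ^+ 2]; hence 128. The minimum with 1 keeps [e] in the range of the
    tail bounds. *)
Definition ut_lambda (eps del : R) : R := 128 * ln del^-1 / Num.min eps 1 ^+ 2.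

Lemma ut_lambda_gt0 (eps del : R) : 0 < eps -> 0 < del < 1 -> 0 < ut_lambda eps del.
Proof.
move=> eps0 /andP[d0 d1]; rewrite /ut_lambda divr_gt0 ?exprn_gt0 ?lt_min ?eps0 ?ltr01//.
by rewrite mulr_gt0 ?ln_gt0// invf_gt1.
Qed.

Lemma sum_delta_swap k (x y : 'I_k) : x != y ->
  exists c : {ffun msg k -> nat},
    \sum_j delta (j, x == j) = c + (delta (x, true) + delta (y, false)) /\
    \sum_j delta (j, y == j) = c + (delta (y, true) + delta (x, false)).
Proof.
move=> xy; exists (\sum_(j | (j != x) && (j != y)) delta (j, false)); split.
  rewrite (bigD1 x)//= (bigD1 y) ?(eq_sym y)//= eqxx (negbTE xy) addrA addrC; congr (_ + _).
  by apply: eq_bigr => j /andP[jx _]; rewrite eq_sym (negbTE jx).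
rewrite (bigD1 x)//= (bigD1 y) ?(eq_sym y)//= eqxx (negbTE xy) addrA addrC.
congr (_ + _); last exact: addrC.
by apply: eq_bigr => j /andP[_ jy]; rewrite eq_sym (negbTE jy).
Qed.

Lemma base_cnt_adjacent k m (xs xs' : {ffun 'I_m -> 'I_k}) :
  Defs.adjacent xs xs' -> xs != xs' ->
  exists x y (c : {ffun msg k -> nat}), [/\ (0 < m)%N, x != y,
    base_cnt xs = c + (delta (x, true) + delta (y, false)) &
    base_cnt xs' = c + (delta (y, true) + delta (x, false))].
Proof.
move=> adj neq.
have [i di] : exists i, xs i != xs' i.
  apply/existsP; apply: contraT; rewrite negb_exists => /forallP h.
  case/eqP: neq; apply/ffunP => i; apply/eqP; move: (h i); by rewrite negbK.
have same j : j != i -> xs j = xs' j.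
  move=> ji; apply/eqP; apply: contraT => dj.
  move: adj; rewrite /Defs.adjacent leqNgt (cardD1 i) inE di (cardD1 j) !inE dj ji //.
have [c [e1 e2]] := sum_delta_swap di.
exists (xs i), (xs' i), (\sum_(j | j != i) \sum_l delta (l, xs j == l) + c); split=> //.
- exact: leq_ltn_trans (ltn_ord i).
- by rewrite /base_cnt (bigD1 i)//= e1 addrC addrA.
- rewrite /base_cnt (bigD1 i)//= e2 addrC addrA; congr (_ + _ + _).
  by apply: eq_bigr => j /same ->.
Qed.

Lemma shuffler_prob_ge0 k m N (lam : R) (xs : {ffun 'I_m -> 'I_k}) S : 0 <= lam ->
  (0 <= shuffler_prob N lam xs S)%E.
Proof.
move=> lam0; rewrite shuffler_probE//; apply: Epois_ge0 => [_|v].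
  by rewrite mulr_ge0 ?divr_ge0.
by rewrite lee_fin shuffle_prob_ge0.
Qed.

Lemma shuffler_prob_le1 k m N (lam : R) (xs : {ffun 'I_m -> 'I_k}) S : 0 <= lam ->
  (shuffler_prob N lam xs S <= 1)%E.
Proof.
move=> lam0; have r0 (_ : msg k) : 0 <= m%:R * (lam / N%:R / 2) by rewrite mulr_ge0 ?divr_ge0.
rewrite shuffler_probE// -(Epois_const r0); apply: le_Epois => // v.
by rewrite lee_fin shuffle_prob_le1.
Qed.

Lemma ut_private k (gam eps del : R) : 0 < gam -> 0 < eps -> 0 < del < 1 ->
  robustly_shuffle_private k (ut_lambda eps del) (2 * eps) (4 * del `^ gam) gam.
Proof.
move=> g0 eps0 del01 N m gN mN xs xs' adj S.
have lam0 := ut_lambda_gt0 eps0 del01.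
have sp0 ys := @shuffler_prob_ge0 k m N _ ys S (ltW lam0).
have exp1 : 1 <= expR (2 * eps) by rewrite -expR0 ler_expR mulr_ge0// ltW.
have dg0 : 0 < del `^ gam by rewrite powR_gt0; case/andP: del01.
(* If the additive term is at least 1 the bound is trivial; otherwise [expR (- L) < 4^-1], which
   yields the condition [8^-1 <= L] of the upper tail. *)
have [big|small] := leP 1 (4 * del `^ gam).
  apply: (le_trans (shuffler_prob_le1 _ _ _ (ltW lam0))).
  by rewrite (@le_trans _ _ (4 * del `^ gam)%:E)// leeDr// mule_ge0// lee_fin expR_ge0.
have [<-|neq] := eqVneq xs xs'.
  rewrite (@le_trans _ _ ((expR (2 * eps))%:E * shuffler_prob N (ut_lambda eps del) xs S)%E)//.
    by rewrite -[leLHS]mul1e lee_wpmul2r// lee_fin.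
  by rewrite leeDl// lee_fin mulr_ge0// ltW.
have [x [y [c [m0 xy exs exs']]]] := base_cnt_adjacent adj neq.
pose e := Num.min eps 1; pose L := gam * ln del^-1.
have e0 : 0 < e by rewrite lt_min eps0 ltr01.
have e1 : e <= 1 by rewrite ge_min lexx orbT.
have N0 : (0 < N)%N by exact: leq_trans mN.
have eL : expR (- L) = del `^ gam.
  rewrite /powR gt_eqF; last by case/andP: del01.
  by rewrite /L lnV ?mulrN ?opprK// posrE; case/andP: del01.
have L0 : 8^-1 <= L.
  by have := expR_ge1Dx (- L); rewrite eL; lra.
pose rho := m%:R * (ut_lambda eps del / N%:R / 2).
have rho0 : 0 < rho.
  by apply: mulr_gt0; [rewrite ltr0n|do 2 (apply: divr_gt0; rewrite ?ltr0n//)].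
have rhoL : 64 * L / e ^+ 2 <= rho.
  rewrite /rho /ut_lambda -/e.
  have -> : 64 * L / e ^+ 2 = gam * (64 * ln del^-1 / e ^+ 2) by rewrite /L; ring.
  have -> : m%:R * (128 * ln del^-1 / e ^+ 2 / N%:R / 2) =
    m%:R / N%:R * (64 * ln del^-1 / e ^+ 2).
    by rewrite (_ : 128 = 64 * 2); [field|lra]; rewrite !gt_eqF ?ltr0n.
  rewrite ler_wpM2r//; last by rewrite ler_pdivlMr ?ltr0n.
  rewrite divr_ge0 ?exprn_ge0 ?(ltW e0)// mulr_ge0// ln_ge0// ltW// invf_gt1//.
  by case/andP: del01. by case/andP: del01.
rewrite !shuffler_probE ?(ltW lam0)// exs exs'.
pose g (v : {ffun msg k -> nat}) := shuffle_prob R (cnt_repr (v + c)) S.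
have main := @Epois_two_shifts R _ rho e L e0 e1 L0 rho0 rhoL
  (x, true) (y, false) (y, true) (x, false) g.
have gE (v d : {ffun msg k -> nat}) : shuffle_prob R (cnt_repr (v + (c + d))) S = g (v + d).
  by rewrite /g addrA (addrAC v).
under eq_Epois do rewrite gE; under [in leRHS]eq_Epois do rewrite gE.
rewrite -eL; apply: (le_trans (main _ _ _)) => [||v|].
- by rewrite xpair_eqE andbF.
- by rewrite xpair_eqE andbF.
- by rewrite shuffle_prob_ge0 shuffle_prob_le1.
rewrite leeD2r// lee_wpmul2r//.
  by apply: Epois_ge0 => [_|v]; [exact: ltW rho0|rewrite lee_fin; exact: shuffle_prob_ge0].
by rewrite lee_fin ler_expR ler_wpM2l// ge_min lexx.
Qed.

End Privacy.

(** * Moments and Chebyshev bound *)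

Section Moments.
Variables (R : realType) (J : finType) (r : J -> R).
Hypothesis r0 : forall x, 0 <= r x.
Implicit Types (v : {ffun J -> nat}) (x : J) (f g H : {ffun J -> nat} -> R).

(* Expectation of a signed function: \esum is only meaningful for nonnegative terms. *)
Definition hasE f (y : R) := exists f1 f2 a1 a2,
  [/\ (forall v, 0 <= f1 v) /\ (forall v, 0 <= f2 v), (forall v, f v = f1 v - f2 v),
      Epois r (EFin \o f1) = a1%:E, Epois r (EFin \o f2) = a2%:E & y = a1 - a2].

Lemma eq_hasE f g y z : (forall v, f v = g v) -> y = z -> hasE f y -> hasE g z.
Proof.
move=> fg -> [f1 [f2 [a1 [a2 [p e E1 E2 E3]]]]].
by exists f1, f2, a1, a2; split => // v; rewrite -fg.
Qed.

Lemma hasED f g y z : hasE f y -> hasE g z -> hasE (fun v => f v + g v) (y + z).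
Proof.
move=> [f1 [f2 [a1 [a2 [[p1 p2] e E1 E2 ->]]]]] [g1 [g2 [b1 [b2 [[q1 q2] e' F1 F2 ->]]]]].
exists (fun v => f1 v + g1 v), (fun v => f2 v + g2 v), (a1 + b1), (a2 + b2); split.
- by split => v; rewrite addr_ge0.
- by move=> v; rewrite e e'; ring.
- by rewrite EFinD -E1 -F1 -EpoisD// => v; rewrite lee_fin.
- by rewrite EFinD -E2 -F2 -EpoisD// => v; rewrite lee_fin.
- by ring.
Qed.

Lemma hasEZ c f y : hasE f y -> hasE (fun v => c * f v) (c * y).
Proof.
move=> [f1 [f2 [a1 [a2 [[p1 p2] e E1 E2 ->]]]]].
have Z d h a : 0 <= d -> (forall v, 0 <= h v) -> Epois r (EFin \o h) = a%:E ->
    Epois r (EFin \o (fun v => d * h v)) = (d * a)%:E.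
  by move=> d0 h0 ha; rewrite EFinM -ha -EpoisZ// => v; rewrite lee_fin.
have [c0|/ltW c0] := leP 0 c.
  exists (fun v => c * f1 v), (fun v => c * f2 v), (c * a1), (c * a2); split.
  - by split => v; rewrite mulr_ge0.
  - by move=> v; rewrite e; ring.
  - exact: Z.
  - exact: Z.
  - by ring.
have c0' : 0 <= - c by rewrite oppr_ge0.
exists (fun v => - c * f2 v), (fun v => - c * f1 v), (- c * a2), (- c * a1); split.
- by split => v; rewrite mulr_ge0.
- by move=> v; rewrite e; ring.
- exact: Z.
- exact: Z.
- by ring.
Qed.

Lemma hasE1 : hasE (fun => 1) 1.
Proof.
exists (fun => 1), (fun => 0), 1, 0; split.
- by split => v.
- by move=> v; rewrite subr0.
- exact: Epois_const.
- by rewrite /Epois esum1// => v _; rewrite mule0.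
- by rewrite subr0.
Qed.

Lemma hasE0 : hasE (fun => 0) 0.
Proof. by apply: eq_hasE (hasEZ 0 hasE1) => [v|]; rewrite mul0r. Qed.

Lemma hasE_sum (I : Type) (s : seq I) (F : I -> {ffun J -> nat} -> R) (y : I -> R) :
  (forall i, hasE (F i) (y i)) -> hasE (fun v => \sum_(i <- s) F i v) (\sum_(i <- s) y i).
Proof.
move=> Fy; elim: s => [|i s IH].
  by apply: eq_hasE hasE0 => [v|]; rewrite big_nil.
by apply: eq_hasE (hasED (Fy i) IH) => [v|]; rewrite big_cons.
Qed.

(** The identity [f + f2 = f1] holds between nonnegative functions, and the finite mean of [f2] is
    then cancelled. *)
Lemma hasE_Epois f y : (forall v, 0 <= f v) -> hasE f y -> Epois r (EFin \o f) = y%:E.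
Proof.
move=> f0 [f1 [f2 [a1 [a2 [[p1 p2] e E1 E2 ->]]]]].
have : (Epois r (EFin \o f) + a2%:E = a1%:E)%E.
  rewrite -E1 -E2 -EpoisD//; try by move=> v; rewrite lee_fin.
  by apply: eq_Epois => v; rewrite /= -EFinD e subrK.
by case: (Epois r _) => //= x [<-]; rewrite addrK.
Qed.

Lemma hasE_shift f x y :
  hasE (fun v => f (v + delta x)) y -> hasE (fun v => (v x)%:R * f v) (r x * y).
Proof.
move=> [f1 [f2 [a1 [a2 [[p1 p2] e E1 E2 ->]]]]].
(* The decomposition given is that of the shifted function, so it is shifted back by [dec]. Where
   [v x = 0] the truncated subtraction is wrong, but the factor [v x] vanishes. *)
pose dec v : {ffun J -> nat} := [ffun z => (v z - (z == x))%N].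
have decK v : dec (v + delta x) = v.
  by apply/ffunP => z; rewrite ffunE vaddE ffunE addnK.
have decKV v : (0 < v x)%N -> dec v + delta x = v.
  by move=> vx; apply/ffunP => z; rewrite vaddE !ffunE subnK//; case: eqP => // ->.
have Z h a : (forall v, 0 <= h v) -> Epois r (EFin \o h) = a%:E ->
    Epois r (EFin \o (fun v => (v x)%:R * h (dec v))) = (r x * a)%:E.
  move=> h0 ha; rewrite EFinM -ha.
  rewrite (_ : EFin \o h = fun v => (h (dec (v + delta x)))%:E); last first.
    by apply/funext => v; rewrite decK.
  rewrite -(Epois_shift r0 (G := fun v => (h (dec v))%:E)) => [|v]; last by rewrite lee_fin.
  by apply: eq_Epois => v; rewrite -EFinM.
exists (fun v => (v x)%:R * f1 (dec v)), (fun v => (v x)%:R * f2 (dec v)).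
exists (r x * a1), (r x * a2); split.
- by split => v; rewrite mulr_ge0.
- move=> v; have [->|vx] := posnP (v x); first by rewrite !mul0r subr0.
  by rewrite -mulrBr -e decKV.
- exact: Z.
- exact: Z.
- by rewrite mulrBr.
Qed.

(** Falling factorial, the basis in which Poisson moments are powers of the rate. *)
Definition ffact (m : nat) (y : R) : R := \prod_(i < m) (y - i%:R).

Lemma ffactS m y : ffact m.+1 y = y * ffact m (y - 1).
Proof.
rewrite /ffact big_ord_recl subr0; congr (_ * _); apply: eq_bigr => i _.
by rewrite lift0 -natr1; ring.
Qed.

(** Each use of the Mecke identity lowers the degree by one. The factor [H], which ignores
    coordinate [x], provides the independence used for covariances. *)
Lemma hasE_ffact m H x y : (forall v, H (v + delta x) = H v) -> hasE H y ->
  hasE (fun v => ffact m (v x)%:R * H v) (r x ^+ m * y).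
Proof.
move=> Hx Hy; elim: m => [|m IH].
  by apply: eq_hasE Hy => [v|]; rewrite ?/ffact ?big_ord0 ?expr0 mul1r.
apply: (eq_hasE (f := fun v => (v x)%:R * (ffact m ((v x)%:R - 1) * H v)) (y := r x * (r x ^+ m * y))).
- by move=> v; rewrite ffactS mulrA.
- by rewrite exprS mulrA.
apply: (hasE_shift (f := fun v => ffact m ((v x)%:R - 1) * H v)).
apply: eq_hasE IH => // v.
by rewrite vaddE [delta x x]ffunE eqxx natrD addrK Hx.
Qed.

(** Subtracting [v x] compensates the Poisson variance, so the first two terms estimate
    [(r x - mu) ^+ 2] without bias. *)
Definition centered (mu : R) (x : J) v : R :=
  ((v x)%:R - mu) ^+ 2 - (v x)%:R - (r x - mu) ^+ 2.

Lemma ffact_expand y : [/\ ffact 0 y = 1, ffact 1 y = y, ffact 2 y = y * (y - 1),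
  ffact 3 y = y * (y - 1) * (y - 2) & ffact 4 y = y * (y - 1) * (y - 2) * (y - 3)].
Proof. by rewrite /ffact !big_ord_recr !big_ord0 /= !mul1r !subr0. Qed.

Lemma hasE_centered_mul mu x H y : (forall v, H (v + delta x) = H v) -> hasE H y ->
  hasE (fun v => centered mu x v * H v) 0.
Proof.
move=> Hx Hy.
apply: eq_hasE (hasED (hasED (hasE_ffact 2 Hx Hy) (hasEZ (- (2 * mu)) (hasE_ffact 1 Hx Hy)))
  (hasEZ (mu ^+ 2 - (r x - mu) ^+ 2) (hasE_ffact 0 Hx Hy))) => [v|].
  have [-> -> -> _ _] := ffact_expand (v x)%:R.
  by rewrite /centered; ring.
by ring.
Qed.

Lemma hasE_centered_sqr mu x :
  hasE (fun v => centered mu x v * centered mu x v)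
       (2 * r x ^+ 2 + 4 * r x * (r x - mu) ^+ 2).
Proof.
pose a := mu ^+ 2 - (r x - mu) ^+ 2.
have F m := hasE_ffact m (H := fun => 1) (x := x) (fun=> erefl) hasE1.
(* The square of [F2 - 2 mu F1 + a] in falling factorials, by [F2^2 = F4 + 4 F3 + 2 F2],
   [F2 F1 = F3 + 2 F2] and [F1^2 = F2 + F1]. *)
apply: eq_hasE (hasED (hasED (hasED (hasED (F 4%N) (hasEZ (4 - 4 * mu) (F 3%N)))
  (hasEZ (2 - 8 * mu + 2 * a + 4 * mu ^+ 2) (F 2%N)))
  (hasEZ (4 * mu ^+ 2 - 4 * a * mu) (F 1%N))) (hasEZ (a ^+ 2) (F 0%N))) => [v|].
  have [-> -> -> -> ->] := ffact_expand (v x)%:R.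
  by rewrite /centered /a; ring.
by rewrite /a; ring.
Qed.

Lemma hasE_centered mu x : hasE (centered mu x) 0.
Proof.
by apply: eq_hasE (hasE_centered_mul mu (x := x) (H := fun => 1) (fun=> erefl) hasE1) => // v;
  rewrite mulr1.
Qed.

(** Distinct coordinates are uncorrelated, so only the diagonal of the double sum survives. *)
Lemma hasE_variance (I : finType) (mu : R) (f : I -> J) : injective f ->
  hasE (fun v => (\sum_i centered mu (f i) v) ^+ 2)
       (\sum_i (2 * r (f i) ^+ 2 + 4 * r (f i) * (r (f i) - mu) ^+ 2)).
Proof.
move=> finj.
pose V i := 2 * r (f i) ^+ 2 + 4 * r (f i) * (r (f i) - mu) ^+ 2.
apply: (eq_hasE (f := fun v => \sum_i \sum_j centered mu (f i) v * centered mu (f j) v)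
  (y := \sum_i \sum_j if i == j then V i else 0)).
- by move=> v; rewrite expr2 mulr_suml; apply: eq_bigr => i _; rewrite mulr_sumr.
- by apply: eq_bigr => i _; rewrite (bigD1 i)//= eqxx big1 ?addr0// => j /negbTE;
    rewrite eq_sym => ->.
apply: hasE_sum => i; apply: hasE_sum => j.
case: eqVneq => [->|ij]; first exact: hasE_centered_sqr.
apply: (hasE_centered_mul mu (H := centered mu (f j)) _ (hasE_centered mu (f j))) => v.
rewrite /centered vaddE [delta _ _]ffunE.
by rewrite (negbTE (_ : f j != f i)) ?addn0//; apply: contra_neq ij => /finj.
Qed.

Lemma Epois_chebyshev (I : finType) (mu c : R) (f : I -> J) (P : {ffun J -> nat} -> bool) :
  injective f -> 0 < c ->
  (forall v, P v -> c <= (\sum_i centered mu (f i) v) ^+ 2) ->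
  (Epois r (fun v => ind R (P v)) <=
   ((\sum_i (2 * r (f i) ^+ 2 + 4 * r (f i) * (r (f i) - mu) ^+ 2)) / c)%:E)%E.
Proof.
move=> finj c0 Pc; rewrite mulrC EFinM -(hasE_Epois _ (hasE_variance mu finj)) => [|v]; last first.
  exact: sqr_ge0.
rewrite -EpoisZ ?invr_ge0 ?(ltW c0)// => [|v]; last by rewrite lee_fin sqr_ge0.
apply: le_Epois => // v; rewrite -EFinM lee_fin mulrC ler_pdivlMr//.
by case: (boolP (P v)) => [/Pc|_]; rewrite ?mul1r// mul0r sqr_ge0.
Qed.

End Moments.

(** * Reduction of the tester to Poisson counts *)

Section Reduction.
Variable R : realType.

Lemma Epois_join (A B : finType) (r : A -> R) (s : B -> R)
    (G : {ffun A -> nat} -> {ffun B -> nat} -> \bar R) :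
  (forall a, 0 <= r a) -> (forall b, 0 <= s b) -> (forall v w, (0 <= G v w)%E) ->
  Epois r (fun v => Epois s (G v)) =
  Epois (fun z : A + B => match z with inl a => r a | inr b => s b end)
    (fun z => G [ffun a => z (inl a)] [ffun b => z (inr b)]).
Proof.
move=> r0 s0 G0.
pose e (z : {ffun A + B -> nat}) := ([ffun a => z (inl a)], [ffun b => z (inr b)]).
transitivity (\esum_(z in [set: {ffun A -> nat} * {ffun B -> nat}])
    ((pois r z.1)%:E * ((pois s z.2)%:E * G z.1 z.2)))%E.
  rewrite -(esum_pair (f := fun v w => ((pois r v)%:E * ((pois s w)%:E * G v w))%E)).
    apply: eq_esum => v _; rewrite -esumZ ?pois_ge0// => w.
    by rewrite mule_ge0// lee_fin pois_ge0.
  by move=> v w; rewrite !mule_ge0 ?G0// lee_fin pois_ge0.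
rewrite (esum_bij (e := e)); last first.
  exists (fun z : {ffun A -> nat} * {ffun B -> nat} =>
      [ffun x => match x with inl a => z.1 a | inr b => z.2 b end]) => [z|[v w]].
    by apply/ffunP => -[a|b]; rewrite !ffunE.
  by congr pair; apply/ffunP => x; rewrite !ffunE.
apply: eq_esum => z _; rewrite muleA -EFinM; congr (_%:E * _)%E.
rewrite /pois big_sumType /=.
by congr (_ * _); apply: eq_bigr => x _; rewrite ffunE.
Qed.

Variable k : nat.

(** Keeps the honest messages equal to [(j, true)], the ones that the statistic reads; they depend
    on the data only through the sample counts. *)
Definition lift_ones (w : {ffun 'I_k -> nat}) : {ffun msg k -> nat} :=
  [ffun y => if y.2 then w y.1 else 0%N].

(** Superposition of noise and sample counts: merging the letter [inl j] with [(j, true)] adds [s j]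
    to the noise rate there. *)
Lemma Epois_lift_ones (a : R) (s : 'I_k -> R) (G : {ffun msg k -> nat} -> \bar R) :
  0 <= a -> (forall j, 0 <= s j) -> (forall u, (0 <= G u)%E) ->
  Epois s (fun w => Epois (fun => a) (fun v => G (v + lift_ones w))) =
  Epois (fun y => a + if y.2 then s y.1 else 0) G.
Proof.
move=> a0 s0 G0.
rewrite (Epois_join (r := s) (s := fun => a) (G := fun w v => G (v + lift_ones w)))//.
pose f (z : 'I_k + msg k) : msg k := match z with inl j => (j, true) | inr y => y end.
have bigf (T : nmodType) (F : 'I_k -> T) (H : msg k -> T) y :
    \sum_(z | f z == y) match z with inl j => F j | inr y => H y end =
    H y + if y.2 then F y.1 else 0.
  rewrite big_sumType /= addrC big_pred1_eq; congr (_ + _).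
  case: y => j [] /=.
    by rewrite (eq_bigl (pred1 j)) ?big_pred1_eq// => i; rewrite /= xpair_eqE andbT.
  by rewrite big_pred0// => i; rewrite xpair_eqE andbF.
rewrite (_ : (fun y : msg k => a + if y.2 then s y.1 else 0) = (fun y =>
    \sum_(z | f z == y) match z with inl j => s j | inr _ => a end)); last first.
  by apply/funext => y; rewrite bigf.
rewrite -Epois_vmap// => [|[]//].
apply: eq_Epois => z; congr (G _); apply/ffunP => y; rewrite !ffunE.
rewrite -(bigf _ (fun j => z (inl j)) (fun y => z (inr y))).
by apply: eq_bigr => -[].
Qed.

Definition ut_test (n lam alpha : R) (u : {ffun msg k -> nat}) : bool :=
  2 * n * alpha ^+ 2 < k%:R / n * \sum_(j < k)
    (((u (j, true))%:R - (n / k%:R + lam / 2)) ^+ 2 - (u (j, true))%:R).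

Lemma UT_outputE n lam alpha (out : seq (msg k)) :
  UT_output n lam alpha out = ut_test n lam alpha (cnt out).
Proof.
rewrite /UT_output /UT_stat /ut_test; congr (_ < _ * _).
by apply: eq_bigr => j _; rewrite ffunE.
Qed.

Lemma shuffle_prob_UT n lam alpha b (u : {ffun msg k -> nat}) :
  shuffle_prob R (cnt_repr u) [set out | UT_output n lam alpha out = b] =
  (ut_test n lam alpha u == b)%:R.
Proof.
apply: shuffle_prob_det => t /seq.permP tu /=; rewrite UT_outputE.
rewrite (_ : cnt t = u); first by split => [->|/eqP].
by rewrite -[RHS]cnt_reprK; apply/ffunP => y; rewrite !ffunE tu.
Qed.

Lemma ut_test_base m n lam alpha (xs : {ffun 'I_m -> 'I_k}) v :
  ut_test n lam alpha (v + base_cnt xs) =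
  ut_test n lam alpha (v + lift_ones (cnt [seq xs i | i <- enum 'I_m])).
Proof.
rewrite /ut_test; congr (_ < _ * _); apply: eq_bigr => j _.
rewrite !vaddE (_ : base_cnt xs _ = lift_ones (cnt [seq xs i | i <- enum 'I_m]) (j, true))//.
rewrite /lift_ones [RHS]ffunE /= ffunE count_map -sum1_count big_enum_cond /= sum_ffunE.
rewrite [RHS]big_mkcond; apply: eq_bigr => i _.
rewrite sum_ffunE (bigD1 j)//= big1 => [|j' j'j].
  by rewrite addr0 ffunE xpair_eqE eqxx; case: (xs i == j).
by rewrite ffunE xpair_eqE eq_sym (negbTE j'j).
Qed.

Definition ut_rate (n lam : R) (p : 'I_k -> R) (y : msg k) : R :=
  lam / 2 + if y.2 then n * p y.1 else 0.

Lemma ut_rate_ge0 n lam p y : 0 <= n -> 0 <= lam -> (forall j, 0 <= p j) ->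
  0 <= ut_rate n lam p y.
Proof.
by move=> n0 l0 p0; rewrite /ut_rate addr_ge0 ?divr_ge0//; case: y.2; rewrite ?mulr_ge0.
Qed.

(* The protocol with no users adds no noise at all: this event of probability exp (- n) is the
   only discrepancy with independent Poisson counts. *)
Lemma UT_prob_ge (n lam alpha : R) (p : 'I_k -> R) (b : bool) :
  0 <= n -> 0 <= lam -> prob_dist p ->
  (Epois (ut_rate n lam p) (fun u => ind R (ut_test n lam alpha u == b)) <=
   UT_prob n lam alpha p b + (expR (- n))%:E)%E.
Proof.
move=> n0 lam0 [p0 p1].
have l20 : 0 <= lam / 2 by rewrite divr_ge0.
pose G u := ind R (ut_test n lam alpha u == b).
have G0 u : (0 <= G u)%E by exact: ind_ge0.
have G1 u : (G u <= 1)%E by rewrite /G /ind lee_fin lern1 leq_b1.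
pose H w := Epois (fun => lam / 2) (fun v => G (v + lift_ones w)).
have H0 w : (0 <= H w)%E by apply: Epois_ge0.
have H1 w : (H w <= 1)%E.
  rewrite -[leRHS](Epois_const (r := fun _ : msg k => lam / 2))//.
  exact: le_Epois.
have P0 N (xs : {ffun 'I_N -> 'I_k}) : 0 <= \prod_(i < N) p (xs i) by apply: prodr_ge0.
have poi0 N : (0 <= (poi n N)%:E)%E by rewrite lee_fin poi_ge0.
rewrite /ut_rate -(Epois_lift_ones (s := fun j => n * p j))// => [|j]; last by rewrite mulr_ge0.
rewrite -/H -esum_poi_ffun//.
have -> : (expR (- n))%:E = (\esum_(N in [set: nat]) if N == 0%N then (poi n N)%:E else 0)%E.
  rewrite -(@esum_set1 _ _ 0%N (fun => (expR (- n))%:E)) ?lee_fin ?expR_ge0//.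
  rewrite esum_mkcond; apply: eq_esum => -[|N] _.
    by rewrite mem_set// /poi expr0 fact0 mulr1 divr1.
  by rewrite memNset.
have S0 N (F : {ffun 'I_N -> 'I_k} -> \bar R) : (forall xs, 0 <= F xs)%E ->
    (0 <= \sum_(xs : {ffun 'I_N -> 'I_k}) (\prod_(i < N) p (xs i))%:E * F xs)%E.
  by move=> F0; apply: sume_ge0 => xs _; rewrite mule_ge0// lee_fin.
rewrite /UT_prob -esumD; last 2 first.
- by move=> N _; rewrite mule_ge0// S0// => xs; exact: shuffler_prob_ge0.
- by move=> N _; case: ifP.
apply: le_esum => -[|N] _ /=.
  (* For [N = 0] the left side is bounded by the mass [expR (- n)] of this event alone. *)
  rewrite (@le_trans _ _ (poi n 0)%:E)//; last first.
    by rewrite leeDr// mule_ge0// S0// => xs; exact: shuffler_prob_ge0.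
  rewrite -[leRHS]mule1 lee_wpmul2l//.
  have := Eseq_const 0 p0; rewrite p1 expr1n Eseq_ffun => <-.
  by apply: lee_sum => xs _; apply: lee_wpmul2l; rewrite ?lee_fin ?P0 ?H1.
rewrite adde0; apply: lee_wpmul2l => //; apply: lee_sum => xs _.
apply: lee_wpmul2l; first by rewrite lee_fin; exact: P0.
(* When all [N.+1] users are honest, their number cancels and the noise rate is [lam / 2] for every
   [N]. *)
rewrite shuffler_probE// (_ : (fun=> _) = (fun _ : msg k => lam / 2)); last first.
  have := pnatr_eq0 R N.+1; move: (N.+1%:R) => c /negbT c0.
  by apply/funext => _; field.
apply: le_Epois => // v.
by rewrite shuffle_prob_UT ut_test_base.
Qed.

(** The budget is [1 - 4^-1 - 12^-1 = 2 / 3], with [expR (- n) <= (1 + n)^-1 <= 12^-1]. *)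
Lemma UT_prob_ge23 (n lam alpha : R) (p : 'I_k -> R) (b : bool) :
  100 <= n -> 0 <= lam -> prob_dist p ->
  (Epois (ut_rate n lam p) (fun u => ind R (ut_test n lam alpha u != b)) <= (4^-1)%:E)%E ->
  ((2 / 3)%:E <= UT_prob n lam alpha p b)%E.
Proof.
move=> n100 lam0 pd wrong.
have n0 : 0 <= n by lra.
have ge := UT_prob_ge alpha b n0 lam0 pd.
have r0 y : 0 <= ut_rate n lam p y by apply: ut_rate_ge0 => //; case: pd.
have en : expR (- n) <= 12^-1.
  have := expR_ge1Dx n; have := expRxMexpNx_1 n; have := expR_gt0 (- n).
  move: (expR n) (expR (- n)) => x y y0 xy x1.
  have h : (1 + n) * y <= x * y by rewrite ler_wpM2r// ltW.
  have h' : 12 * y <= (1 + n) * y by rewrite ler_wpM2r ?ltW//; lra.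
  lra.
have := Epois_const r0.
rewrite (_ : Epois _ _ = Epois (ut_rate n lam p) (fun u =>
    ind R (ut_test n lam alpha u == b) + ind R (ut_test n lam alpha u != b))%E); last first.
  by apply: eq_Epois => u; rewrite /ind -EFinD; case: eqP => _ /=; rewrite ?addr0 ?add0r.
rewrite EpoisD// => [tot|u|u]; [|exact: ind_ge0|exact: ind_ge0].
have : (1 <= UT_prob n lam alpha p b + (12^-1)%:E + (4^-1)%:E)%E.
  rewrite -tot leeD// (le_trans ge)// leeD2l// lee_fin //.
case: (UT_prob _ _ _ _ _) => [x| |]; [|by move=> _; rewrite leey|by []].
by rewrite -!EFinD !lee_fin; lra.
Qed.

End Reduction.

(** * Sample complexity *)

Section Utility.
Variable R : realType.

(** The last two hypotheses say that [n] is at least 100 times [kap^(1/2) / alpha^2] and 100 times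
    [kap^(3/4) lam^(1/2) / alpha]. They control the two terms of the mean through
    [(x + y)^2 <= 2 x^2 + 2 y^2]. *)
Lemma mean_sqr_le (kap n lam alpha : R) : 0 < kap -> 0 <= lam ->
  100 ^+ 2 * kap <= n ^+ 2 * alpha ^+ 4 ->
  100 ^+ 4 * (kap ^+ 3 * lam ^+ 2) <= n ^+ 4 * alpha ^+ 4 ->
  kap ^+ 3 * (n / kap + lam / 2) ^+ 2 <= 3 / (100 ^+ 2) * (n ^+ 4 * alpha ^+ 4).
Proof.
move=> k0 l0 Ha Hb.
have -> : kap ^+ 3 * (n / kap + lam / 2) ^+ 2 = kap * (n + kap * lam / 2) ^+ 2.
  by field; rewrite gt_eqF.
have h1 : 0 <= kap * (n - kap * lam / 2) ^+ 2 by rewrite mulr_ge0 ?sqr_ge0// ltW.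
have h2 : n ^+ 2 * (100 ^+ 2 * kap) <= n ^+ 2 * (n ^+ 2 * alpha ^+ 4).
  by rewrite ler_wpM2l ?sqr_ge0.
have h3 : 0 <= kap ^+ 3 * lam ^+ 2 by rewrite mulr_ge0 ?sqr_ge0// exprn_ge0// ltW.
lra.
Qed.

(** Both [mu] and [D] are at most [Del / 200], so every term is a small multiple of [Del ^+ 2]. *)
Lemma variance_le (kap mu D Del : R) : 1 <= kap -> 0 <= mu -> 0 <= D -> Del = D ^+ 2 ->
  (4 * 100 ^+ 2) <= Del -> kap * mu ^+ 2 <= 3 / (16 * 100 ^+ 2) * Del ^+ 2 ->
  4 * (kap * mu ^+ 2) + 4 * Del + 4 * (mu * Del) + 4 * (D * Del) <= Del ^+ 2 / 16.
Proof.
move=> k1 mu0 D0 DelD Del4 kmu.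
have Del0 : 0 <= Del by lra.
have muD : mu <= Del / 200.
  rewrite -(@ler_pXn2r _ 2) ?nnegrE ?divr_ge0//.
  have : 0 <= (kap - 1) * mu ^+ 2 by rewrite mulr_ge0 ?sqr_ge0// subr_ge0.
  have : 0 <= Del ^+ 2 by exact: sqr_ge0.
  by lra.
have DD : D <= Del / 200.
  have D200 : 200 <= D.
    by rewrite -(@ler_pXn2r _ 2) ?nnegrE// -DelD; lra.
  have : 0 <= D * (D - 200) by rewrite mulr_ge0// subr_ge0.
  by rewrite DelD; lra.
have h1 : mu * Del <= Del / 200 * Del by rewrite ler_wpM2r.
have h2 : D * Del <= Del / 200 * Del by rewrite ler_wpM2r.
have h3 : (4 * 100 ^+ 2) * Del <= Del * Del by rewrite ler_wpM2r.
lra.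
Qed.

(** Cauchy-Schwarz, from the nonnegativity of the empirical variance of the [|d i|]. *)
Lemma sqr_sum_norm_le (I : finType) (d : I -> R) :
  (\sum_i `|d i|) ^+ 2 <= #|I|%:R * \sum_i d i ^+ 2.
Proof.
set s := \sum_i `|d i|.
have [I0|I0] := posnP #|I|.
  have -> : s = 0 by apply: big_pred0 => i; have := card0_eq I0 i.
  by rewrite expr0n I0 mul0r.
set c : R := #|I|%:R; have c0 : 0 < c by rewrite ltr0n.
have : 0 <= \sum_i (`|d i| - s / c) ^+ 2 by apply: sumr_ge0 => i _; exact: sqr_ge0.
under eq_bigr do rewrite sqrrB real_normK ?num_real//.
rewrite big_split /= sumrB.
have -> : \sum_(i : I) (s / c) ^+ 2 = c * (s / c) ^+ 2.
  by rewrite sumr_const [RHS]mulr_natl; congr (_ *+ _); exact: eq_card.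
have -> : \sum_i `|d i| * (s / c) *+ 2 = 2 * s * (s / c).
  by rewrite sumrMnl -mulr_suml -/s; ring.
move=> h; have := mulr_ge0 (ltW c0) h.
have -> : c * (\sum_i d i ^+ 2 - 2 * s * (s / c) + c * (s / c) ^+ 2) =
   c * \sum_i d i ^+ 2 - s ^+ 2.
  by field; rewrite gt_eqF.
by rewrite subr_ge0.
Qed.

Lemma ut_solves (k : nat) (n lam alpha : R) : (0 < k)%N -> 100 <= n -> 0 <= lam -> 0 < alpha < 1 ->
  100 ^+ 2 * k%:R <= n ^+ 2 * alpha ^+ 4 ->
  100 ^+ 4 * (k%:R ^+ 3 * lam ^+ 2) <= n ^+ 4 * alpha ^+ 4 ->
  solves_UT k n lam alpha.
Proof.
move=> k0 n100 lam0 /andP[a0 a1] Ha Hb.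
have n0 : 0 < n by lra.
set kap : R := k%:R in Ha Hb *.
have kap0 : 0 < kap by rewrite ltr0n.
have kap1 : 1 <= kap by rewrite ler1n.
have mub := mean_sqr_le kap0 lam0 Ha Hb.
set mu := n / kap + lam / 2 in mub *.
have mu0 : 0 <= mu by rewrite addr_ge0 ?divr_ge0// ltW.
have n4 : 0 <= n ^+ 4 * alpha ^+ 4 by rewrite mulr_ge0 ?exprn_ge0// ltW.
(* The threshold [2 * n * alpha ^+ 2] after removing the factor [k / n] from the statistic. *)
pose tau := 2 * n ^+ 2 * alpha ^+ 2 / kap.
have tau0 : 0 < tau by rewrite !mulr_gt0 ?exprn_gt0 ?invr_gt0.
have kmu : kap * mu ^+ 2 <= 3 / (4 * 100 ^+ 2) * tau ^+ 2.
  rewrite -(@ler_pM2l _ (kap ^+ 2)) ?exprn_gt0//.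
  have -> : kap ^+ 2 * (3 / (4 * 100 ^+ 2) * tau ^+ 2) = 3 / (100 ^+ 2) * (n ^+ 4 * alpha ^+ 4).
    by rewrite /tau; field; rewrite gt_eqF.
  by rewrite mulrA -exprSr.
pose ones (j : 'I_k) : msg k := (j, true).
have ones_inj : injective ones by move=> i j [].
have testE (p : 'I_k -> R) u : ut_test n lam alpha u =
    (tau < \sum_j centered (ut_rate n lam p) mu (ones j) u +
           \sum_j (ut_rate n lam p (ones j) - mu) ^+ 2).
  rewrite -big_split /= /ut_test -/kap -/mu.
  under [in RHS]eq_bigr do rewrite /centered subrK.
  rewrite -ltr_pdivrMl ?divr_gt0//; congr (_ < _).
  by rewrite /tau; field; rewrite !gt_eqF.
split.
  have pd : prob_dist (@unif R k).
    split => [j|]; first by rewrite invr_ge0.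
    by rewrite /unif sumr_const card_ord -[LHS]mulr_natl mulfV// gt_eqF.
  apply: UT_prob_ge23 => //.
  have rE j : ut_rate n lam (@unif R k) (ones j) = mu by rewrite /ut_rate /= addrC.
  apply: (@le_trans _ _ (_ / tau ^+ 2)%:E);
    first apply: (Epois_chebyshev (mu := mu) _ ones_inj) => [y||u].
  - by apply: ut_rate_ge0 => //; [exact: ltW|case: pd].
  - by rewrite exprn_gt0.
  - rewrite eqbF_neg negbK (testE (@unif R k)).
    rewrite [X in _ < _ + X]big1 ?addr0 => [h|j _]; last by rewrite rE subrr expr0n.
    by rewrite ler_pXn2r ?nnegrE ?(ltW tau0) ?(ltW h)// (ltW (lt_trans tau0 h)).
  under eq_bigr do rewrite rE subrr expr0n mulr0 addr0.
  rewrite lee_fin ler_pdivrMr ?exprn_gt0// sumr_const card_ord -[_ *+ k]mulr_natl -/kap.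
  have := sqr_ge0 tau; lra.
move=> p pd dist; have [p0 p1] := pd.
have r0 y : 0 <= ut_rate n lam p y by apply: ut_rate_ge0 => //; exact: ltW.
apply: UT_prob_ge23 => //.
pose d j := ut_rate n lam p (ones j) - mu.
have dE j : d j = n * (p j - kap^-1).
  by rewrite /d /ut_rate /mu /=; ring.
pose Del := \sum_j d j ^+ 2.
(* By Cauchy-Schwarz [kap * Del >= (2 * n * alpha) ^+ 2]. The mean is thus at least twice the
   threshold, and an error forces a deviation of at least [Del / 2]. *)
have Del2 : 2 * tau <= Del.
  have := sqr_sum_norm_le d; rewrite card_ord -/kap -/Del.
  under eq_bigr do rewrite dE normrM (gtr0_norm n0).
  rewrite -mulr_sumr => h.
  have h2 : 2 * alpha <= \sum_(j < k) `|p j - kap^-1|.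
    by move: dist; rewrite /dTV /unif -/kap; lra.
  have h3 : (n * (2 * alpha)) ^+ 2 <= kap * Del.
    have S0 : 0 <= \sum_(j < k) `|p j - kap^-1| by exact: sumr_ge0.
    apply: le_trans h; rewrite ler_pXn2r ?nnegrE ?(mulr_ge0 (ltW n0))//; last first.
      by rewrite mulr_ge0// ltW.
    by rewrite ler_wpM2l// ltW.
  rewrite -(@ler_pM2l _ kap)//; apply: le_trans h3.
  by rewrite /tau le_eqVlt; apply/orP; left; apply/eqP; field; rewrite gt_eqF.
have tau4 : 2 * 100 ^+ 2 <= tau.
  rewrite /tau ler_pdivlMr//.
  have : n ^+ 2 * alpha ^+ 4 <= n ^+ 2 * alpha ^+ 2.
    by rewrite ler_wpM2l ?sqr_ge0// ler_wiXn2l ?(ltW a0) ?(ltW a1).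
  lra.
have Del0 : 0 < Del by lra.
apply: (@le_trans _ _ (_ / (Del ^+ 2 / 4))%:E);
    first apply: (Epois_chebyshev (mu := mu) r0 ones_inj) => [|u].
- by rewrite divr_gt0 ?exprn_gt0.
- rewrite eqb_id (testE p) -/Del -leNgt; move: (\sum_j _) => T hT.
  have hT' : Del / 2 <= - T by lra.
  rewrite -[T ^+ 2]sqrrN (_ : Del ^+ 2 / 4 = (Del / 2) ^+ 2); last by field.
  rewrite ler_pXn2r ?nnegrE//; lra.
rewrite lee_fin ler_pdivrMr ?divr_gt0 ?exprn_gt0//.
rewrite (_ : 4^-1 * (Del ^+ 2 / 4) = Del ^+ 2 / 16); last by field.
pose D := Num.sqrt Del.
have DD : Del = D ^+ 2 by rewrite sqr_sqrtr ?ltW.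
apply: le_trans (variance_le kap1 mu0 (sqrtr_ge0 _) DD _ _); last 2 first.
- by lra.
- apply: (le_trans kmu).
  have : tau ^+ 2 * 4 <= Del ^+ 2.
    have -> : tau ^+ 2 * 4 = (2 * tau) ^+ 2 by ring.
    by rewrite ler_pXn2r ?nnegrE ?(ltW Del0)// mulr_ge0// ltW.
  lra.
(* The bound is spread over the coordinates; the cubic term [4 * d j ^+ 3] of the variance is
   handled by [d j <= D]. *)
have -> : 4 * (kap * mu ^+ 2) + 4 * Del + 4 * (mu * Del) + 4 * (D * Del) =
    \sum_(j < k) (4 * mu ^+ 2 + 4 * d j ^+ 2 + 4 * mu * d j ^+ 2 + 4 * D * d j ^+ 2).
  by rewrite !big_split /= -!mulr_sumr sumr_const card_ord -/Del -[_ *+ k]mulr_natl -/kap; ring.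
apply: ler_sum => j _.
have -> : ut_rate n lam p (ones j) = mu + d j by rewrite /d addrC subrK.
rewrite [mu + d j - mu]addrAC subrr add0r.
have djD : d j <= D.
  rewrite (le_trans (ler_norm _))// -sqrtr_sqr ler_wsqrtr// /Del (bigD1 j)//= lerDl.
  by apply: sumr_ge0 => i _; exact: sqr_ge0.
have h1 : d j * d j ^+ 2 <= D * d j ^+ 2 by rewrite ler_wpM2r ?sqr_ge0.
have h2 : 0 <= (mu - d j) ^+ 2 by exact: sqr_ge0.
lra.
Qed.

End Utility.

(** * From the stated sample complexity to the moment conditions *)

Section Rate.
Variable R : realType.

(** This is where [eps = O(1)] enters: [eps <= Num.min eps 1 * Num.max 1 eps0]. *)
Lemma ut_lambda_le (eps0 eps del : R) : 0 < eps <= eps0 -> 0 < del < 1 ->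
  ut_lambda eps del <= 128 * Num.max 1 eps0 ^+ 2 * ln del^-1 / eps ^+ 2.
Proof.
move=> /andP[e0 ee0] /andP[d0 d1].
have l0 : 0 <= ln del^-1 by rewrite ln_ge0// ltW// invf_gt1.
have m0 : 0 < Num.min eps 1 by rewrite lt_min e0 ltr01.
have M1 : 1 <= Num.max 1 eps0 by rewrite le_max lexx.
have M2 : eps0 <= Num.max 1 eps0 by rewrite le_max lexx orbT.
have mM : eps <= Num.min eps 1 * Num.max 1 eps0.
  rewrite /Num.min; case: ifP => _; first by rewrite ler_peMr// ltW.
  by rewrite mul1r (le_trans ee0).
rewrite /ut_lambda; move: (Num.min eps 1) (Num.max 1 eps0) m0 M1 mM => a b a0 b1 eab.
have ab2 : eps ^+ 2 <= (a * b) ^+ 2.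
  by rewrite ler_pXn2r ?nnegrE ?(ltW e0)// (le_trans (ltW e0) eab).
rewrite ler_pdivrMr ?exprn_gt0// mulrAC ler_pdivlMr ?exprn_gt0//.
have := ler_wpM2l l0 ab2; lra.
Qed.

Lemma ut_sample_bounds (K kap n eps alpha ell lam : R) :
  1 <= K -> 1 <= kap -> 0 < eps -> 0 < alpha < 1 -> 0 <= ell -> 0 <= lam ->
  lam <= K * ell / eps ^+ 2 ->
  100 * K * (kap `^ (3 / 4) / (alpha * eps) * Num.sqrt ell + Num.sqrt kap / alpha ^+ 2) <= n ->
  [/\ 100 <= n, 100 ^+ 2 * kap <= n ^+ 2 * alpha ^+ 4 &
      100 ^+ 4 * (kap ^+ 3 * lam ^+ 2) <= n ^+ 4 * alpha ^+ 4].
Proof.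
move=> K1 k1 e0 /andP[a0 a1] l0 lam0 lamK nge.
have k0 : 0 < kap by lra.
pose A := kap `^ (3 / 4) / (alpha * eps) * Num.sqrt ell.
pose B := Num.sqrt kap / alpha ^+ 2.
have A0 : 0 <= A by rewrite mulr_ge0 ?sqrtr_ge0// divr_ge0 ?powR_ge0// ltW// mulr_gt0.
have B0 : 0 <= B by rewrite divr_ge0 ?sqrtr_ge0 ?exprn_ge0// ltW.
have C0 : 0 <= 100 * K by lra.
have AB : 100 * K * A <= n /\ 100 * K * B <= n.
  by rewrite -/A -/B in nge; have := mulr_ge0 C0 A0; have := mulr_ge0 C0 B0; lra.
have [nA nB] := AB.
have nB' : 100 * B <= n.
  have : 0 <= (K - 1) * B by rewrite mulr_ge0// subr_ge0.
  by lra.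
have n0 : 0 <= n by lra.
have a2 : 0 < alpha ^+ 2 by rewrite exprn_gt0.
have Bn : 100 * Num.sqrt kap <= n * alpha ^+ 2.
  by rewrite -ler_pdivrMr// -mulrA.
split.
- have s1 : 1 <= Num.sqrt kap by rewrite -[leLHS]sqrtr1 ler_wsqrtr.
  have : n * alpha ^+ 2 <= n * 1 by rewrite ler_wpM2l// exprn_ile1 ?(ltW a0) ?(ltW a1).
  lra.
- have -> : n ^+ 2 * alpha ^+ 4 = (n * alpha ^+ 2) ^+ 2 by ring.
  rewrite -{1}(sqr_sqrtr (ltW k0)) -exprMn.
  by rewrite ler_pXn2r ?nnegrE ?(mulr_ge0 n0 (ltW a2))// mulr_ge0 ?sqrtr_ge0.
have An : 100 * K * (kap `^ (3 / 4) * Num.sqrt ell) <= n * (alpha * eps).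
  rewrite -ler_pdivrMr ?mulr_gt0//; apply: le_trans nA.
  by rewrite /A le_eqVlt; apply/orP; left; apply/eqP; ring.
have p0 : 0 <= kap `^ (3 / 4) := powR_ge0 _ _.
have : (100 * K * (kap `^ (3 / 4) * Num.sqrt ell)) ^+ 4 <= (n * (alpha * eps)) ^+ 4.
  rewrite ler_pXn2r ?nnegrE//; last exact: mulr_ge0 n0 (ltW (mulr_gt0 a0 e0)).
  by apply: mulr_ge0 => //; apply: mulr_ge0 => //; exact: sqrtr_ge0.
have -> : (100 * K * (kap `^ (3 / 4) * Num.sqrt ell)) ^+ 4 =
    100 ^+ 4 * K ^+ 4 * (kap ^+ 3 * ell ^+ 2).
  have k34 : (kap `^ (3 / 4)) ^+ 4 = kap ^+ 3.
    rewrite -powR_mulrn// -powRrM -powR_mulrn ?ltW//; congr (_ `^ _); by field.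
  have s4 : Num.sqrt ell ^+ 4 = ell ^+ 2 by rewrite -[in RHS](sqr_sqrtr l0) -exprM.
  by rewrite !exprMn k34 s4.
move=> h.
have lam2 : (lam * eps ^+ 2) ^+ 2 <= (K * ell) ^+ 2.
  have h1 : 0 <= lam * eps ^+ 2 by rewrite mulr_ge0// sqr_ge0.
  have h2 : 0 <= K * ell by rewrite mulr_ge0//; lra.
  by rewrite ler_pXn2r ?nnegrE// -ler_pdivlMr ?exprn_gt0.
have e4 : 0 < eps ^+ 4 by rewrite exprn_gt0.
rewrite -(ler_pM2r e4).
have -> : n ^+ 4 * alpha ^+ 4 * eps ^+ 4 = (n * (alpha * eps)) ^+ 4 by ring.
apply: le_trans h.
have -> : 100 ^+ 4 * (kap ^+ 3 * lam ^+ 2) * eps ^+ 4 =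
  100 ^+ 4 * (kap ^+ 3 * (lam * eps ^+ 2) ^+ 2) by ring.
(* The bound on [lam] costs [K ^+ 2], while the fourth power of the sample bound offers [K ^+ 4];
   [1 <= K] closes the gap. *)
have K4 : K ^+ 2 <= K ^+ 4 by rewrite ler_weXn2l.
have lam4 : (lam * eps ^+ 2) ^+ 2 <= K ^+ 4 * ell ^+ 2.
  by apply: (le_trans lam2); rewrite exprMn ler_wpM2r// sqr_ge0.
have k3 : 0 <= kap ^+ 3 by rewrite exprn_ge0// ltW.
have := ler_wpM2l k3 lam4; lra.
Qed.

End Rate.

Theorem theorem3p2 (R : realType) :
  exists lam : R -> R -> R,
    (forall eps del : R, 0 < eps -> 0 < del < 1 -> 0 < lam eps del) /\
    (forall (k : nat) (gam eps del : R), (2 <= k)%N -> 0 < gam <= 1 ->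
       0 < eps -> 0 < del < 1 ->
       robustly_shuffle_private k (lam eps del) (2 * eps) (4 * del `^ gam) gam) /\
    (forall eps0 : R, 0 < eps0 ->
       exists C del0 : R, 0 < C /\ 0 < del0 < 1 /\
       forall (k : nat) (eps del alpha n : R), (2 <= k)%N ->
         0 < eps <= eps0 -> 0 < del <= del0 -> 0 < alpha < 1 ->
         C * (k%:R `^ (3 / 4) / (alpha * eps) * Num.sqrt (ln del^-1)
              + Num.sqrt k%:R / alpha ^+ 2) <= n ->
         solves_UT k n (lam eps del) alpha).
Proof.
exists (@ut_lambda R); split; first exact: ut_lambda_gt0.
split=> [k gam eps del _ /andP[g0 _]|eps0 eps00]; first exact: ut_private.
pose K : R := 128 * Num.max 1 eps0 ^+ 2.
have M1 : 1 <= Num.max 1 eps0 by rewrite le_max lexx.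
have K1 : 1 <= K by have := exprn_ege1 2 M1; rewrite /K; lra.
(* [K] is the constant in [lambda <= K * ln del^-1 / eps ^+ 2], and 100 is the margin of the
   Chebyshev estimates. *)
exists (100 * K), 2^-1; split; first by rewrite mulr_gt0// (lt_le_trans ltr01).
split; first by rewrite invr_gt0 ltr0n invf_lt1// ltr1n.
move=> k eps del alpha n k2 eps01 /andP[d0 d2] a01 nge.
have del01 : 0 < del < 1 by rewrite d0 (le_lt_trans d2)// invf_lt1// ltr1n.
have [e0 _] := andP eps01.
have lam0 := ltW (ut_lambda_gt0 e0 del01).
have l0 : 0 <= ln del^-1 by case/andP: del01 => _ d1; rewrite ln_ge0// ltW// invf_gt1.
have k1 : 1 <= k%:R :> R by rewrite ler1n (leq_trans _ k2).
have [n100 Ha Hb] := ut_sample_bounds K1 k1 e0 a01 l0 lam0 (ut_lambda_le eps01 del01) nge.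
by apply: ut_solves => //; exact: leq_trans k2.
Qed.
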